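(* Let $X$ be a normed linear space and $Y$ a Banach space such that the pair $(X,Y)$ has properties (LE) and (LA$_1$), both with the same constant $C\ge1$. Let $\Omega\subset X$ be an open connected set and let $A\subset\Omega$ be relatively closed (in $\Omega$). Suppose that $f\colon A\to Y$ is $L$-Lipschitz and satisfies condition (W) with $G\colon A\to\mathcal L(X;Y)$ such that $\sup_{x\in A}\|G(x)\|\le L$. Then $f$ can be extended to a $16C^3L$-Lipschitz mapping $g\in C^1(\Omega;Y)$ such that $Dg=G$ on $A$.
   Context: All normed linear spaces are real. $U(x,r)$ is the open ball with centre $x$ and radius $r$, $U_X$ is the open unit ball of $X$. An $L$-Lipschitz mapping is a mapping with a (not necessarily minimal) Lipschitz constant $L$. $\mathcal L(X;Y)$ is the normed space of continuous linear operators from $X$ to $Y$. $Dg$ is the Fréchet derivative. For open $\Omega\subset X$, $C^k(\Omega;Y)$ is the space of $C^k$-smooth (in the Fréchet sense) mappings from $\Omega$ to $Y$. Condition (W): a mapping $f\colon A\to Y$, $A\subset X$, satisfies condition (W) with $G$ if $G\colon A\to\mathcal L(X;Y)$ is continuous and for each $x\in A$ the operator $G(x)$ is a strict derivative of $f$ at $x$ with respect to $A$, i.e. for each $\varepsilon>0$ there is $\delta>0$ such that $\|f(z)-f(y)-G(x)[z-y]\|\le\varepsilon\|z-y\|$ whenever $y,z\in U(x,\delta)\cap A$. Property (LE) with $C$: the pair $(X,Y)$ of normed linear spaces has property (LE) with $C>0$ if for every $A\subset X$ every $L$-Lipschitz mapping $f\colon A\to Y$ has a $CL$-Lipschitz extension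 to the whole of $X$. Property (LA$_k$) with $C$, $k\in\mathbb N\cup\{\infty\}$: the pair $(X,Y)$ of normed linear spaces has property (LA$_k$) with $C\ge0$ if for any $L$-Lipschitz mapping $f\colon U_X\to Y$ and any $\varepsilon>0$ there is a $CL$-Lipschitz mapping $g\in C^k(U_X;Y)$ such that $\sup_{U_X}\|f-g\|\le\varepsilon$. *)

(* Defs.v *)
From HB Require Import structures.
From mathcomp Require Import all_boot all_order all_algebra.
From mathcomp Require Import all_classical all_reals all_analysis.

Set Implicit Arguments.
Unset Strict Implicit.
Unset Printing Implicit Defensive.

Import Order.TTheory GRing.Theory Num.Theory.
Import numFieldNormedType.Exports.

Local Open Scope classical_set_scope.
Local Open Scope ring_scope.

(* A mapping defined on a subset [A] of [X] is represented by a
   total function on [X] of which only the values on [A] are ever used. *)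

Section ContinuousLinearOperators.
Context {R : realType} (X Y : normedModType R).

Definition is_clinear : {pred X -> Y} :=
  [pred T : X -> Y | `[< linear T /\ continuous T >]].

Lemma is_clinearP (T : X -> Y) :
  reflect (linear T /\ continuous T) (T \in is_clinear).
Proof. exact: asboolP. Qed.

Lemma is_clinear_submod_closed : submod_closed is_clinear.
Proof.
split.
  apply/is_clinearP; split; last exact: cst_continuous.
  by move=> a u v; rewrite /= scaler0 addr0.
move=> a S T /is_clinearP[linS cS] /is_clinearP[linT cT]; apply/is_clinearP.
split=> [b u v|x].
  change (a *: S (b *: u + v) + T (b *: u + v) =
    b *: (a *: S u + T u) + (a *: S v + T v)).
  by rewrite linS linT !scalerDr !scalerA (mulrC b a) addrACA.
apply: continuousD; last exact: cT.
by apply: continuousZl_tmp; exact: cS.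
Qed.

HB.instance Definition _ :=
  GRing.isSubmodClosed.Build R (X -> Y) is_clinear is_clinear_submod_closed.

Record clinear := CLinear {
  clinear_fun :> X -> Y ;
  _ : clinear_fun \in is_clinear }.

HB.instance Definition _ := [isSub for clinear_fun].
HB.instance Definition _ := [Choice of clinear by <:].
HB.instance Definition _ := [SubChoice_isSubLmodule of clinear by <:].

Implicit Types S T : clinear.

Lemma clinear_linear T : linear T.
Proof. by have /is_clinearP[] := valP T. Qed.

HB.instance Definition _ T :=
  GRing.isLinear.Build R X Y *:%R T (clinear_linear T).

Lemma clinear_continuous T : continuous T.
Proof. by have /is_clinearP[] := valP T. Qed.

Definition opnorm T : R := sup [set `|T x| | x in [set x : X | `|x| <= 1]].

Lemma opnorm_has_sup T :
  has_sup [set `|T x| | x in [set x : X | `|x| <= 1]].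
Proof.
split; first by exists `|T 0|, 0 => //=; rewrite normr0.
have /linear_boundedP/pinfty_ex_gt0[M M0 TM] :=
  @continuous_linear_bounded R X Y 0 T (@clinear_continuous T 0).
exists M => _ [x /= x1 <-]; apply: (le_trans (TM x)).
by rewrite ler_piMr// ltW.
Qed.

Lemma opnorm_ge0 T : 0 <= opnorm T.
Proof.
apply: ub_le_sup; first by have [] := opnorm_has_sup T.
by exists 0; rewrite /= ?normr0// linear0 normr0.
Qed.

Lemma ler_opnorm T (x : X) : `|T x| <= opnorm T * `|x|.
Proof.
have [->|x0] := eqVneq x 0; first by rewrite linear0 !normr0 mulr0.
have nx0 : 0 < `|x| by rewrite normr_gt0.
rewrite -ler_pdivrMr//; apply: ub_le_sup; first by have [] := opnorm_has_sup T.
exists (`|x|^-1 *: x).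
  by rewrite /= normrZ normfV normr_id mulVf// gt_eqF.
by rewrite linearZ normrZ normfV normr_id mulrC.
Qed.

Lemma opnorm_le T (M : R) :
  0 <= M -> (forall x, `|T x| <= M * `|x|) -> opnorm T <= M.
Proof.
move=> M0 TM; apply: ge_sup; first by have [] := opnorm_has_sup T.
by move=> _ [x /= x1 <-]; apply: (le_trans (TM x)); rewrite ler_piMr.
Qed.

Lemma ler_opnormD S T : opnorm (S + T) <= opnorm S + opnorm T.
Proof.
apply: opnorm_le => [|x]; first by rewrite addr_ge0 ?opnorm_ge0.
by rewrite mulrDl (le_trans (ler_normD _ _))// lerD ?ler_opnorm.
Qed.

Lemma opnormZ_le (a : R) T : opnorm (a *: T) <= `|a| * opnorm T.
Proof.
apply: opnorm_le => [|x]; first by rewrite mulr_ge0 ?opnorm_ge0.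
by rewrite [leLHS]normrZ -mulrA ler_wpM2l ?ler_opnorm.
Qed.

Lemma opnormZ (a : R) T : opnorm (a *: T) = `|a| * opnorm T.
Proof.
apply/eqP; rewrite eq_le opnormZ_le /=.
have [->|a0] := eqVneq a 0; first by rewrite normr0 mul0r opnorm_ge0.
rewrite -ler_pdivlMl ?normr_gt0// -normfV.
by rewrite -[in leLHS](scalerK a0 T) opnormZ_le.
Qed.

Lemma opnorm0_eq0 T : opnorm T = 0 -> T = 0.
Proof.
move=> T0; apply/val_inj/funext => x; apply/eqP.
by rewrite -[_ == _]normr_le0 (le_trans (ler_opnorm T x))// T0 mul0r.
Qed.

HB.instance Definition _ :=
  Lmodule_isNormed.Build R clinear ler_opnormD opnormZ opnorm0_eq0.

End ContinuousLinearOperators.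

Section Properties.
Context {R : realType}.

(* Only meaningful where [f] is differentiable; the default value [0] serves
   when the library's ['d f x] is not a continuous linear map. *)
Definition frechet (X Y : normedModType R) (f : X -> Y) (x : X) :
  clinear X Y := insubd 0 ('d f x : X -> Y).

Lemma frechetE (X Y : normedModType R) (f : X -> Y) (x : X) :
  differentiable f x -> frechet f x = 'd f x :> (X -> Y).
Proof.
move=> df; rewrite /frechet val_insubd ifT//; apply/is_clinearP.
by split; [exact: linearP|exact: diff_continuous].
Qed.

Definition C1_on (X Y : normedModType R) (Omega : set X) (f : X -> Y) : Prop :=
  (forall x, Omega x -> differentiable f x) /\
  {within Omega, continuous (frechet f)}.

Definition strict_derivative (X Y : normedModType R) (A : set X) (f : X -> Y)
    (x : X) (T : clinear X Y) : Prop :=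
  forall e : R, 0 < e -> exists2 d : R, 0 < d &
    forall y z, (ball x d `&` A) y -> (ball x d `&` A) z ->
      `|f z - f y - T (z - y)| <= e * `|z - y|.

Definition condition_W (X Y : normedModType R) (A : set X) (f : X -> Y)
    (G : X -> clinear X Y) : Prop :=
  {within A, continuous G} /\ forall x, A x -> strict_derivative A f x (G x).

(* Lipschitz constants are nonnegative: the library's [L.-lipschitz_A f] allows
   [L < 0] when [A] has at most one point. *)
Definition property_LE (X Y : normedModType R) (C : R) : Prop :=
  0 < C /\
  forall (A : set X) (L : R) (f : X -> Y), 0 <= L -> L.-lipschitz_A f ->
    exists2 g : X -> Y, (C * L).-lipschitz g & forall x, A x -> g x = f x.

Definition property_LA1 (X Y : normedModType R) (C : R) : Prop :=
  0 <= C /\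
  forall (L : R) (f : X -> Y) (e : R), 0 <= L ->
    L.-lipschitz_(ball 0 1) f -> 0 < e ->
    exists g : X -> Y, [/\ (C * L).-lipschitz_(ball 0 1) g,
      C1_on (ball 0 1) g & forall x, ball 0 1 x -> `|f x - g x| <= e].

End Properties.

(* Main.v *)
Require Import Defs.
From mathcomp Require Import all_boot all_order all_algebra.
From mathcomp Require Import all_classical all_reals all_analysis.
From mathcomp Require wochoice.
From mathcomp Require Import ring lra.

(** Everything rests on one approximation result: if $f$ is $L$-Lipschitz on
    $A$ and satisfies (W) with $G$ and $\|G\|\le L$, then there is a
    $4C^2L$-Lipschitz map $g\in C^1(\Omega;Y)$ such that $f-g$ is
    $L/2$-Lipschitz on $A$ and $\|G-Dg\|\le L/2$ on $A$ ([C1_approximation]).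
    The pair $(f-g,G-Dg)$ satisfies the same hypotheses with $L/2$ in place of
    $L$; iterating and adding up the approximations, all normalised at one
    point of $A$, gives a map $g$ that is equal to $f$ on $A$, with $Dg=G$
    there, and is $8C^2L$-Lipschitz ([C1_extension]).

    To find the approximation, $f$ is first extended to a map $F$ on $X$ that
    is Lipschitz and such that around each $a\in A$ the map $F-G(a)$ has a
    small Lipschitz constant. By (W) and (LE) there are such extensions for
    each single $a$; they all agree with $f$ on $A$, and therefore a partition
    of unity glues them near $A$ at a negligible cost ([near_extension]). The
    glued map is Lipschitz on a neighbourhood of $A$, and (LE) extends it from
    there to $X$ ([lipschitz_near_extension]).

    Then $F$ is smoothed: $F-G(a)$ near $A$, and $F$ elsewhere, are
    approximated on small balls by (LA$_1$), and the approximations are glued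
    ([smoothing]). If the errors are small compared with the Lipschitz
    constants of the weights, gluing does not spoil the local Lipschitz
    constants ([glue_lip_mod]). If the error near each point is also small
    compared with its distance to the complement of $\Omega$, the glued map is
    globally Lipschitz: along segments in $\Omega$ the local bounds add up
    ([local_lip_mod_segment]), and if the segment leaves $\Omega$ then $F$,
    which is Lipschitz on $X$, may be used instead.

    The partition of unity ([C1_partition]) consists of $C^1$ functions whose
    Lipschitz constants are controlled. Property (LA$_1$) passes from $Y$ to
    the real line through a functional of norm one ([norming_functional]) and
    gives bumps ([bump]) around the members of a discrete refinement of the
    cover ([discrete_refinement]).

    On open sets, $C^1$ maps are the same as maps that are strictly
    differentiable at every point ([C1_onP]). Working with strict derivatives
    turns differentiability into Lipschitz estimates, which are easily added,
    glued, and passed to the limit. *)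

Set Implicit Arguments.
Unset Strict Implicit.
Unset Printing Implicit Defensive.

Import Order.TTheory GRing.Theory Num.Theory.
Import numFieldNormedType.Exports.

Local Open Scope classical_set_scope.
Local Open Scope ring_scope.

(** * Identities in abelian groups *)

Section ZmodCancel.
Context {V : zmodType}.
Implicit Types a b r : V.

Lemma cancel_opp a r r' : r = - a + r' -> r' = 0 -> a + r = 0.
Proof. by move=> -> ->; rewrite addr0 subrr. Qed.

Lemma cancel_pos a r r' : r = a + r' -> r' = 0 -> - a + r = 0.
Proof. by move=> -> ->; rewrite addr0 addNr. Qed.

Lemma pull_head a b r r' : r = a + r' -> b + r = a + (b + r').
Proof. by move=> ->; rewrite addrCA. Qed.

Lemma pull_last a : a = a + 0.
Proof. by rewrite addr0. Qed.
End ZmodCancel.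

(** Identities between sums and differences in an abelian group: move
    everything to one side, flatten, and cancel each term against its
    opposite. *)
Ltac pull_syntactic := match goal with
  | |- Algebra.add ?x _ = Algebra.add ?x _ => reflexivity
  | |- Algebra.add _ _ = Algebra.add _ _ => apply: pull_head; pull_syntactic
  | |- ?x = Algebra.add ?x _ => exact: pull_last
  end.
Ltac pull_convertible :=
  first [reflexivity | exact: pull_last | apply: pull_head; pull_convertible].
Ltac pull := first [pull_syntactic | pull_convertible].
Ltac zmod :=
  apply/eqP; rewrite -subr_eq0; apply/eqP;
  rewrite ?(opprD, opprK) -?addrA ?(addr0, add0r, oppr0);
  repeat match goal with
  | |- Algebra.add (Algebra.opp _) _ = _ =>
      refine (cancel_pos (a:=_) _ _); [pull|]
  | |- Algebra.add _ _ = _ => refine (cancel_opp (a:=_) _ _); [pull|]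
  end;
  rewrite ?(addr0, add0r); try reflexivity.

(** * Maps that are Lipschitz up to a linear map *)

Section LipMod.
Context {R : realType} {X Y : normedModType R}.
Implicit Types (U V : set X) (S T : clinear X Y) (f g : X -> Y) (k l : R).

(** A common language for the two kinds of estimates of the proof: for $T=0$ it
    is the Lipschitz property on $U$, and $T$ is a strict derivative of $f$ at
    $x$ when the constant can be made arbitrarily small by taking for $U$ small
    balls around $x$.  It is stable under sums, and replacing $T$ by $T'$ costs
    only $\|T-T'\|$. *)
Definition lip_mod U T l f := forall y z, U y -> U z ->
  `|f z - f y - T (z - y)| <= l * `|z - y|.

Lemma clinearB T x y : T (x - y) = T x - T y.
Proof. exact: (raddfB T). Qed.

Lemma clinearZ T a x : T (a *: x) = a *: T x.
Proof. by rewrite linearZ. Qed.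

Lemma clinearD T x y : T (x + y) = T x + T y.
Proof. exact: (raddfD T). Qed.

Lemma lip_modS U V T l f : U `<=` V -> lip_mod V T l f -> lip_mod U T l f.
Proof. by move=> UV h y z /UV Uy /UV Uz; exact: h. Qed.

Lemma lip_mod_le U T k l f : k <= l -> lip_mod U T k f -> lip_mod U T l f.
Proof.
by move=> kl h y z Uy Uz; apply: (le_trans (h y z Uy Uz)); rewrite ler_wpM2r.
Qed.

Lemma eq_lip_mod U T l f g : (forall x, U x -> f x = g x) ->
  lip_mod U T l f -> lip_mod U T l g.
Proof. by move=> fg h y z Uy Uz; rewrite -!fg//; exact: h. Qed.

Lemma lip_modD U S T k l f g : lip_mod U S k f -> lip_mod U T l g ->
  lip_mod U (S + T) (k + l) (f + g).
Proof.
move=> hf hg y z Uy Uz.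
have -> : (f + g) z - (f + g) y - (S + T) (z - y) =
    (f z - f y - S (z - y)) + (g z - g y - T (z - y)).
  change (f z + g z - (f y + g y) - (S (z - y) + T (z - y)) =
    (f z - f y - S (z - y)) + (g z - g y - T (z - y))).
  zmod.
by rewrite mulrDl (le_trans (ler_normD _ _))// lerD ?hf ?hg.
Qed.

Lemma lip_modN U T l f : lip_mod U T l f -> lip_mod U (- T) l (- f).
Proof.
move=> h y z Uy Uz; rewrite -normrN.
have -> : - ((- f) z - (- f) y - (- T) (z - y)) = f z - f y - T (z - y).
  change (- (- f z - - f y - - T (z - y)) = f z - f y - T (z - y)).
  by rewrite !opprD !opprK.
exact: h.
Qed.

Lemma lip_modB U S T k l f g : lip_mod U S k f -> lip_mod U T l g ->
  lip_mod U (S - T) (k + l) (f - g).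
Proof. by move=> hf /lip_modN; exact: lip_modD. Qed.

Lemma lip_mod_clinear U T : lip_mod U T 0 T.
Proof. by move=> y z _ _; rewrite clinearB subrr normr0 mul0r. Qed.

Lemma lip_mod_cst U (c : Y) : lip_mod U 0 0 (cst c).
Proof.
move=> y z _ _; change (`|c - c - 0| <= 0 * `|z - y|).
by rewrite !subrr normr0 mul0r.
Qed.

Lemma lip_mod_change U S T l f : lip_mod U S l f ->
  lip_mod U T (l + `|S - T|) f.
Proof.
move=> h y z Uy Uz.
have -> : f z - f y - T (z - y) = f z - f y - S (z - y) + (S - T) (z - y).
  change (f z - f y - T (z - y) =
    f z - f y - S (z - y) + (S (z - y) - T (z - y))).
  zmod.
by rewrite mulrDl (le_trans (ler_normD _ _))// lerD ?h ?ler_opnorm.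
Qed.

Lemma lip_mod0P U l f : lip_mod U 0 l f <-> l.-lipschitz_U f.
Proof.
split=> [h [y z] /= [Uy Uz]|h y z Uy Uz].
  by have := h z y Uz Uy; rewrite [X in _ - X](_ : _ = 0)// subr0.
by rewrite [X in _ - X](_ : _ = 0)// subr0; exact: (h (z, y)).
Qed.

Lemma lip_mod0_norm U l f y z : lip_mod U 0 l f -> U y -> U z ->
  `|f z - f y| <= l * `|z - y|.
Proof. by move=> /lip_mod0P h Uy Uz; exact: (h (z, y)). Qed.

End LipMod.

(** * From local to global Lipschitz estimates *)

Section Chain.
Context {R : realType}.

(** A function that is $K$-Lipschitz at each point of a segment is
    $K$-Lipschitz between its ends: the supremum of the parameters up to which
    the estimate from the left end holds is attained, and cannot be smaller
    than the right end. *)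
Lemma local_lipschitz_segment (Y : normedModType R) (K : R) (phi : R -> Y) :
  (forall t, 0 <= t <= 1 -> exists2 d : R, 0 < d &
     forall s, 0 <= s <= 1 -> `|s - t| < d ->
       `|phi s - phi t| <= K * `|s - t|) ->
  `|phi 1 - phi 0| <= K.
Proof.
move=> h; pose S := [set t : R | 0 <= t <= 1 /\ `|phi t - phi 0| <= K * t].
have S0 : S 0 by rewrite /S /= lexx ler01 subrr normr0 mulr0.
have supS : has_sup S.
  by split; [exists 0|exists 1 => t [/andP[]]].
have [m mE] : exists m, m = sup S by exists (sup S).
have m0 : 0 <= m by rewrite mE; apply: ub_le_sup => //; case: supS.
have m1 : m <= 1 by rewrite mE; apply: ge_sup => [|t [/andP[]]//]; exists 0.
have m01 : 0 <= m <= 1 by rewrite m0.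
have [d d0 hd] := h _ m01.
have [s [s01 hs] sm] : exists2 s, S s & m - d < s.
  by rewrite mE; exact: sup_adherent.
have slem : s <= m by rewrite mE; apply: ub_le_sup => //; case: supS.
(* step from a parameter of S close to m up to m itself *)
have Sm : S m.
  split=> //; have := hd s s01; rewrite distrC ger0_norm ?subr_ge0//.
  move=> /(_ ltac:(lra)) hms.
  have -> : phi m - phi 0 = (phi s - phi 0) - (phi s - phi m) by zmod.
  rewrite (le_trans (ler_normB _ _))//; nra.
have [mlt1|] := ltP m 1; last first.
  move=> m1'; have m_eq1 : m = 1 by apply/le_anti; rewrite m1 m1'.
  by case: Sm => _; rewrite m_eq1 mulr1.
(* if m < 1, the estimate extends beyond m *)
pose t := Num.min 1 (m + d / 2).
have mt : m < t by rewrite lt_min mlt1 /=; lra.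
have t1 : t <= 1 by rewrite ge_min lexx.
have td : t <= m + d / 2 by rewrite ge_min lexx orbT.
have t01 : 0 <= t <= 1 by lra.
suff : S t by move=> St; have := ub_le_sup supS.2 St; rewrite -mE; lra.
split=> //; have := hd t t01; rewrite ger0_norm; last lra.
move=> /(_ ltac:(lra)) htm; case: Sm => _ hm.
have -> : phi t - phi 0 = (phi t - phi m) + (phi m - phi 0).
  zmod.
rewrite (le_trans (ler_normD _ _))//; nra.
Qed.

Context {X Y : normedModType R}.

Lemma in_ballE (x : X) (r : R) y : ball x r y = (`|x - y| < r) :> Prop.
Proof. by rewrite -ball_normE. Qed.

Lemma segment_dist (y z : X) (t : R) : 0 <= t <= 1 ->
  `|y - (y + t *: (z - y))| + `|y + t *: (z - y) - z| = `|z - y|.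
Proof.
move=> /andP[t0 t1]; rewrite opprD addrA subrr sub0r normrN normrZ ger0_norm//.
have -> : y + t *: (z - y) - z = (1 - t) *: (y - z).
  by rewrite scalerBl scale1r -[z - y]opprB scalerN addrAC.
by rewrite normrZ (distrC y) ger0_norm ?subr_ge0// -mulrDl subrKC mul1r.
Qed.

(** The previous lemma for $f-T$ along a segment; with a constant that is
    arbitrarily close to the norm of $Df-T$ it is the mean value
    inequality. *)
Lemma local_lip_mod_segment (T : clinear X Y) (K : R) (f : X -> Y) (y z : X) :
  (forall t, 0 <= t <= 1 -> exists2 d : R, 0 < d &
     forall w, `|w - (y + t *: (z - y))| < d ->
       `|f w - f (y + t *: (z - y)) - T (w - (y + t *: (z - y)))|
         <= K * `|w - (y + t *: (z - y))|) ->
  `|f z - f y - T (z - y)| <= K * `|z - y|.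
Proof.
move=> h; pose seg t : X := y + t *: (z - y).
have segB s t : seg s - seg t = (s - t) *: (z - y).
  by rewrite /seg opprD addrACA subrr add0r scalerBl.
pose phi t := f (seg t) - T (seg t).
have -> : f z - f y - T (z - y) = phi 1 - phi 0.
  rewrite /phi /seg scale1r scale0r addr0 subrKC clinearB; zmod.
have [zy|zy] := eqVneq z y.
  by rewrite /phi /seg zy subrr !scaler0 subrr !normr0 mulr0.
have nzy : 0 < `|z - y| by rewrite normr_gt0 subr_eq0.
apply: local_lipschitz_segment => t /h[d d0 hd].
exists (d / `|z - y|); first by rewrite divr_gt0.
move=> s _ std; have := hd (seg s); rewrite -/(seg t) segB normrZ.
rewrite -ltr_pdivlMr// => /(_ std) hst.
have -> : K * `|z - y| * `|s - t| = K * (`|s - t| * `|z - y|) by ring.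
have TB : T ((s - t) *: (z - y)) = T (seg s) - T (seg t).
  by rewrite -segB clinearB.
apply: le_trans hst; rewrite TB /phi le_eqVlt; apply/orP; left.
by apply/eqP; congr (`|_|); zmod.
Qed.

Lemma ball_segment (x : X) (r : R) (y z : X) (t : R) : 0 <= t <= 1 ->
  ball x r y -> ball x r z -> ball x r (y + t *: (z - y)).
Proof.
move=> /andP[t0 t1]; rewrite !in_ballE => xy xz.
have -> : x - (y + t *: (z - y)) = (1 - t) *: (x - y) + t *: (x - z).
  rewrite scalerBl scale1r !scalerBr; zmod.
have [->|tn0] := eqVneq t 0; first by rewrite subr0 scale1r scale0r addr0.
have tp : 0 < t by rewrite lt_neqAle eq_sym tn0.
rewrite (le_lt_trans (ler_normD _ _))// !normrZ ger0_norm; last lra.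
rewrite ger0_norm//; nra.
Qed.

Lemma local_lip_mod_ball (T : clinear X Y) (K : R) (f : X -> Y) x r :
  (forall p, ball x r p -> exists2 d : R, 0 < d &
     forall w, `|w - p| < d -> `|f w - f p - T (w - p)| <= K * `|w - p|) ->
  lip_mod (ball x r) T K f.
Proof.
move=> h y z xy xz; apply: local_lip_mod_segment => t t01.
by apply: h; exact: ball_segment.
Qed.

End Chain.

(** * Calculus of strict derivatives *)

Section StrictDerivative.
Context {R : realType}.

Section Basic.
Context {X Y : normedModType R}.
Implicit Types (U V : set X) (S T : clinear X Y) (f g : X -> Y) (k l e d : R).

Definition strict_diff f x T := forall e, 0 < e ->
  exists2 d, 0 < d & lip_mod (ball x d) T e f.

Definition C1s U f := forall x, U x -> exists T, strict_diff f x T.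

Lemma clinear_norm_le T l :
  0 <= l -> (forall x, `|T x| <= l * `|x|) -> `|T| <= l.
Proof. exact: opnorm_le. Qed.

Lemma clinear_norm T x : `|T x| <= `|T| * `|x|.
Proof. exact: ler_opnorm. Qed.

(** Two linear maps that approximate the same function on a ball are close:
    test the difference on vectors whose translates stay in the ball. *)
Lemma lip_mod_dist y d S T k l f g : 0 < d -> 0 <= k + l ->
  (forall x, ball y d x -> f x = g x) ->
  lip_mod (ball y d) S k f -> lip_mod (ball y d) T l g -> `|S - T| <= k + l.
Proof.
move=> d0 kl0 fg hf hg; have := lip_modB hf hg => h.
apply: clinear_norm_le => // x.
have [->|x0] := eqVneq x 0; first by rewrite raddf0 !normr0 mulr0.
have nx : 0 < `|x| by rewrite normr_gt0.
pose t := d / 2 / `|x|.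
have t0 : 0 < t by rewrite !divr_gt0.
have yt : ball y d (y + t *: x).
  rewrite (@in_ballE R X) opprD addrA subrr sub0r normrN normrZ gtr0_norm//.
  by rewrite /t divfK ?gt_eqF//; lra.
have := h y (y + t *: x) (ballxx _ d0) yt.
have -> : y + t *: x - y = t *: x by zmod.
rewrite clinearZ.
have -> : (f - g) (y + t *: x) = 0.
  by change (f (y + t *: x) - g (y + t *: x) = 0); rewrite fg// subrr.
have -> : (f - g) y = 0.
  by change (f y - g y = 0); rewrite fg ?subrr//; exact: ballxx.
have nt : `|t| = t by rewrite gtr0_norm.
by rewrite subrr sub0r normrN !(normrZ t) nt [leRHS]mulrCA ler_pM2l.
Qed.

Lemma strict_diff_eq f g x r T : 0 < r -> (forall y, ball x r y -> f y = g y) ->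
  strict_diff f x T -> strict_diff g x T.
Proof.
move=> r0 fg h e /h[d d0 hd]; exists (Num.min d r); first by rewrite lt_min d0.
have sub s : Num.min d r <= s -> ball x (Num.min d r) `<=` ball x s.
  by move=> ?; exact: le_ball.
apply: (@eq_lip_mod _ _ _ _ _ _ f); last first.
  by apply: lip_modS hd; apply: sub; rewrite ge_min lexx.
by move=> y /(sub r); rewrite ge_min lexx orbT => /(_ isT); exact: fg.
Qed.

(** It is enough to reach the estimate up to a fixed factor. *)
Lemma strict_diff_upto f x T (M : R) : 0 <= M ->
  (forall e, 0 < e <= 1 -> exists2 d, 0 < d & lip_mod (ball x d) T (M * e) f) ->
  strict_diff f x T.
Proof.
move=> M0 h e e0; pose e' := Num.min 1 (e / (M + 1)).
have M1 : 0 < M + 1 by lra.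
have e'0 : 0 < e' by rewrite lt_min ltr01 divr_gt0.
have [|d d0 hd] := h e'; first by rewrite e'0 ge_min lexx.
exists d => //; apply: lip_mod_le hd.
have : e' <= e / (M + 1) by rewrite ge_min lexx orbT.
by rewrite ler_pdivlMr//; nra.
Qed.

Lemma strict_diff_lip f x T : strict_diff f x T ->
  exists2 K : R, 0 <= K & exists2 d, 0 < d & lip_mod (ball x d) 0 K f.
Proof.
move=> /(_ _ ltr01)[d d0 hd]; exists (1 + `|T - 0|); first by rewrite addr_ge0.
by exists d => //; exact: lip_mod_change hd.
Qed.

Lemma strict_diffD f g x S T : strict_diff f x S -> strict_diff g x T ->
  strict_diff (f + g) x (S + T).
Proof.
move=> hf hg; apply: (@strict_diff_upto _ _ _ 2) => // e /andP[e0 _].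
have [d1 d10 h1] := hf _ e0; have [d2 d20 h2] := hg _ e0.
exists (Num.min d1 d2); first by rewrite lt_min d10.
have -> : 2 * e = e + e by lra.
apply: lip_modD.
- by apply: lip_modS h1; apply: le_ball; rewrite ge_min lexx.
- by apply: lip_modS h2; apply: le_ball; rewrite ge_min lexx orbT.
Qed.

Lemma strict_diffN f x T : strict_diff f x T -> strict_diff (- f) x (- T).
Proof. by move=> h e /h[d d0 /lip_modN]; exists d. Qed.

Lemma strict_diffB f g x S T : strict_diff f x S -> strict_diff g x T ->
  strict_diff (f - g) x (S - T).
Proof. by move=> hf /strict_diffN; exact: strict_diffD. Qed.

Lemma strict_diff_cst c x : strict_diff (cst c) x 0.
Proof.
move=> e e0; exists 1 => //; apply: (@lip_mod_le _ _ _ _ _ 0); first exact: ltW.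
exact: lip_mod_cst.
Qed.

Lemma strict_diff_clinear T x : strict_diff T x T.
Proof.
move=> e e0; exists 1 => //; apply: (@lip_mod_le _ _ _ _ _ 0); first exact: ltW.
exact: lip_mod_clinear.
Qed.

Lemma C1s_sum U (P : pred nat) (F : nat -> X -> Y) N :
  (forall n, (n < N)%N -> P n -> C1s U (F n)) ->
  C1s U (fun x => \sum_(n < N | P n) F n x).
Proof.
elim: N => [|N IH] h x Ux.
  exists 0; apply: (@strict_diff_eq (cst 0) _ _ 1) => //.
    by move=> y _; rewrite big_ord0.
  exact: strict_diff_cst.
have [|T hT] := IH _ x Ux; first by move=> n nN; apply: h; exact: ltnW.
have [PN|PN] := boolP (P N); last first.
  exists T; apply: strict_diff_eq hT => // y _.
  by rewrite [RHS]big_mkcond big_ord_recr /= (negbTE PN) addr0 -big_mkcond.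
have [S hS] := h N (ltnSn N) PN x Ux.
exists (T + S); apply: (strict_diff_eq ltr01 _ (strict_diffD hT hS)) => y _.
by rewrite [RHS]big_mkcond big_ord_recr /= PN -big_mkcond.
Qed.

End Basic.

Section Comp.
Context {X Y Z : normedModType R}.

Lemma comp_clinear_subproof (S : clinear Y Z) (T : clinear X Y) :
  S \o T \in @is_clinear R X Z.
Proof.
apply/is_clinearP; split; first by move=> a u v /=; rewrite !linearP.
move=> x; apply: continuous_comp; exact: clinear_continuous.
Qed.

Definition comp_clinear S T : clinear X Z :=
  CLinear (comp_clinear_subproof S T).

Lemma strict_diff_comp (g : Y -> Z) (f : X -> Y) x S T :
  strict_diff f x T -> strict_diff g (f x) S ->
  strict_diff (g \o f) x (comp_clinear S T).
Proof.
move=> hf hg; have [K K0 [r r0 hr]] := strict_diff_lip hf.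
apply: (@strict_diff_upto _ _ _ _ _ (K + `|S|)); first by rewrite addr_ge0.
move=> e /andP[e0 _]; have [d1 d10 h1] := hf _ e0; have [d2 d20 h2] := hg _ e0.
have K1 : 0 < K + 1 by lra.
pose d := Num.min (Num.min d1 r) (d2 / (K + 1)).
have dd1 : d <= d1 by rewrite /d !ge_min lexx.
have dr : d <= r by rewrite /d !ge_min lexx !orbT.
have dd2 : d <= d2 / (K + 1) by rewrite /d !ge_min lexx !orbT.
have d0 : 0 < d by rewrite !lt_min d10 r0 divr_gt0.
exists d => //.
have fd y : ball x d y -> ball (f x) d2 (f y).
  move=> xy; have := lip_mod0_norm hr (le_ball dr xy) (ballxx _ r0).
  move: xy dd2; rewrite !(@in_ballE R X) !(@in_ballE R Y) ler_pdivlMr//.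
  by move=> xy dd2; nra.
move=> y z xy xz.
have A := h2 _ _ (fd _ xy) (fd _ xz).
have B := h1 _ _ (le_ball dd1 xy) (le_ball dd1 xz).
have C := lip_mod0_norm hr (le_ball dr xy) (le_ball dr xz).
(* linearise g at f x first, and then f at x *)
have -> : (g \o f) z - (g \o f) y - comp_clinear S T (z - y) =
   (g (f z) - g (f y) - S (f z - f y)) + S (f z - f y - T (z - y)).
  by rewrite (clinearB S (f z - f y)) /=; zmod.
have D := clinear_norm S (f z - f y - T (z - y)).
rewrite (le_trans (ler_normD _ _))// (le_trans (lerD A D))//.
rewrite [leRHS]mulrAC mulrDl mulrDl lerD//.
  by rewrite mulrC ler_wpM2r// ltW.
rewrite -mulrA ler_wpM2l// (le_trans B)// mulrC//.
Qed.

Lemma scale_clinear_subproof (S : clinear X R) (c : Y) :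
  (fun x => S x *: c) \in @is_clinear R X Y.
Proof.
apply/is_clinearP; split.
  by move=> a u v; rewrite clinearD clinearZ scalerDl scalerA.
by move=> x; apply: continuousZr_tmp; exact: clinear_continuous.
Qed.

Definition scale_clinear S c : clinear X Y :=
  CLinear (scale_clinear_subproof S c).

(** The product rule: the derivative is $v \mapsto u(x) Tv + (Sv) f(x)$, and the
    error splits into the four terms t1, ..., t4 of the proof, each of which
    contains one small factor. *)
Lemma strict_diffZ (u : X -> R) (f : X -> Y) x (S : clinear X R) T :
  strict_diff u x S -> strict_diff f x T ->
  strict_diff (fun y => u y *: f y) x (u x *: T + scale_clinear S (f x)).
Proof.
move=> hu hf.
have [Ku Ku0 [r r0 hr]] := strict_diff_lip hu.
have [Kf Kf0 [s s0 hs]] := strict_diff_lip hf.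
pose M := (`|u x| + Ku) + Ku * `|T| + (`|f x| + Kf) + `|S| * Kf.
have M0 : 0 <= M by rewrite /M !addr_ge0// mulr_ge0.
apply: (strict_diff_upto M0) => e /andP[e0 e1].
have [d1 d10 h1] := hu _ e0; have [d2 d20 h2] := hf _ e0.
pose d := Num.min (Num.min d1 d2) (Num.min (Num.min r s) e).
have dd1 : d <= d1 by rewrite /d !ge_min lexx.
have dd2 : d <= d2 by rewrite /d !ge_min lexx !orbT.
have dr : d <= r by rewrite /d !ge_min lexx !orbT.
have ds : d <= s by rewrite /d !ge_min lexx !orbT.
have de : d <= e by rewrite /d !ge_min lexx !orbT.
have d0 : 0 < d by rewrite !lt_min d10 d20 r0 s0.
exists d => // y z xy xz.
have xx := ballxx x d0.
have A := h2 _ _ (le_ball dd2 xy) (le_ball dd2 xz).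
have B := h1 _ _ (le_ball dd1 xy) (le_ball dd1 xz).
have C := lip_mod0_norm hr (le_ball dr xx) (le_ball dr xz).
have D := lip_mod0_norm hs (le_ball ds xx) (le_ball ds xy).
have E := clinear_norm T (z - y).
have F := clinear_norm S (z - y).
have : `|z - x| < d by rewrite distrC -(@in_ballE R X).
have : `|y - x| < d by rewrite distrC -(@in_ballE R X).
set h := `|z - y| in A B E F *; have h0 : 0 <= h by exact: normr_ge0.
move=> yx zx.
have C' : `|u z - u x| <= Ku * e by rewrite (le_trans C)// ler_wpM2l//; lra.
have D' : `|f y - f x| <= Kf * e by rewrite (le_trans D)// ler_wpM2l//; lra.
have uz : `|u z| <= `|u x| + Ku.
  have : `|u z| <= `|u x| + `|u z - u x|.
    by rewrite -{1}(subrKC (u x) (u z)) ler_normD.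
  nra.
have fy : `|f y| <= `|f x| + Kf.
  have : `|f y| <= `|f x| + `|f y - f x|.
    by rewrite -{1}(subrKC (f x) (f y)) ler_normD.
  nra.
pose t1 := u z *: (f z - f y - T (z - y)).
pose t2 := (u z - u x) *: T (z - y).
pose t3 := (u z - u y - S (z - y)) *: f y.
pose t4 := S (z - y) *: (f y - f x).
have -> : u z *: f z - u y *: f y
    - (u x *: T + scale_clinear S (f x)) (z - y) = t1 + t2 + t3 + t4.
  change (u z *: f z - u y *: f y - (u x *: T (z - y) + S (z - y) *: f x)
    = t1 + t2 + t3 + t4).
  by rewrite /t1 /t2 /t3 /t4 !(scalerBl, scalerBr); zmod.
have n1 : `|t1| <= (`|u x| + Ku) * (e * h) by rewrite normrZ ler_pM.
have n2 : `|t2| <= Ku * e * (`|T| * h) by rewrite normrZ ler_pM.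
have n3 : `|t3| <= e * h * (`|f x| + Kf) by rewrite normrZ ler_pM.
have n4 : `|t4| <= `|S| * h * (Kf * e) by rewrite normrZ ler_pM.
have -> : M * e * h = (`|u x| + Ku) * (e * h) + Ku * e * (`|T| * h)
  + e * h * (`|f x| + Kf) + `|S| * h * (Kf * e) by rewrite /M; ring.
apply: (le_trans (ler_normD _ _)); apply: lerD n4.
apply: (le_trans (ler_normD _ _)); apply: lerD n3.
by apply: (le_trans (ler_normD _ _)); exact: lerD.
Qed.

End Comp.
End StrictDerivative.

(** * Continuously differentiable maps *)

Section C1.
Context {R : realType} {X Y : normedModType R}.
Implicit Types (U : set X) (T : clinear X Y) (f : X -> Y).

Lemma open_ball U x : open U -> U x -> exists2 r : R, 0 < r & ball x r `<=` U.
Proof.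
rewrite openE => oU /oU; rewrite /interior -nbhs_ballE => -[r r0 ?].
by exists r.
Qed.

Lemma differentiable_ball f x : differentiable f x ->
  forall e : R, 0 < e -> exists2 d : R, 0 < d & forall w, `|w - x| < d ->
    `|f w - f x - frechet f x (w - x)| <= e * `|w - x|.
Proof.
move=> df e e0; have /diff_locally/eqaddoP/(_ e e0) := df.
move=> /nbhs_ballP[d /= d0 hd]; exists d => // w wx.
have := hd (w - x); rewrite /= -ball_normE /= sub0r normrN => /(_ wx).
rewrite -(frechetE df); congr (`|_| <= _).
change (f (w - x + x) - (f x + frechet f x (w - x)) =
  f w - f x - frechet f x (w - x)).
by rewrite subrK; zmod.
Qed.

Lemma strict_diff_differentiable f x T : strict_diff f x T ->
  differentiable f x /\ frechet f x = T.
Proof.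
move=> h.
have hT : f \o shift x = cst (f x) + T +o_ 0 id.
  apply/eqaddoP => e /h[d d0 hd]; apply/nbhs_ballP; exists d => // v.
  rewrite /= -ball_normE /= sub0r normrN => vd.
  have := hd x (v + x) (ballxx x d0).
  rewrite in_ballE opprD addrCA subrr addr0 normrN => /(_ vd).
  rewrite addrK; congr (`|_| <= _).
  by change (f (v + x) - f x - T v = f (v + x) - (f x + T v)); zmod.
have cT := clinear_continuous (T := T).
have dfT := diff_unique cT hT.
have df : differentiable f x.
  by apply/diff_locallyP; rewrite dfT; split=> // v; exact: cT.
by split=> //; apply: val_inj; rewrite /= (frechetE df) dfT.
Qed.

(** On an open set, being continuously Fréchet differentiable is the same as
    being strictly differentiable at every point.  The mean value inequality
    gives one direction; for the other one, a strict derivative also serves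
    as an approximate derivative at all nearby points, which makes it depend
    continuously on the point. *)
Lemma C1_onP U f : open U -> C1_on U f <-> C1s U f.
Proof.
move=> oU; rewrite /C1_on continuous_open_subspace//; split=> [[df cf] x Ux|cf].
- have [r r0 rU] := open_ball oU Ux.
  exists (frechet f x).
  apply: (@strict_diff_upto _ _ _ _ _ _ 2) => // e /andP[e0 _].
  have := cf x (mem_set Ux) => /cvgrPdist_lt/(_ e e0).
  move=> /nbhs_ballP[d /= d0 hd]; exists (Num.min d r).
    by rewrite lt_min d0.
  apply: local_lip_mod_ball => p px.
  have pr : ball x r p by apply: le_ball px; rewrite ge_min lexx orbT.
  have pd : ball x d p by apply: le_ball px; rewrite ge_min lexx.
  have [s s0 hs] := differentiable_ball (df _ (rU _ pr)) e0.
  exists s => // w /hs{}hs.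
  (* replace the derivative at x by the one at p, which is close to it *)
  have -> : f w - f p - frechet f x (w - p) =
     (f w - f p - frechet f p (w - p)) + - (frechet f x - frechet f p) (w - p).
    change (f w - f p - frechet f x (w - p) = (f w - f p - frechet f p (w - p))
      + - (frechet f x (w - p) - frechet f p (w - p))).
    by zmod.
  rewrite (le_trans (ler_normD _ _))// normrN (_ : 2 * e = e + e); last lra.
  rewrite mulrDl lerD// (le_trans (clinear_norm _ _))// ler_wpM2r//.
  by apply: ltW; exact: hd.
- have hf x : U x -> strict_diff f x (frechet f x).
    by move=> /cf[T hT]; have [_ ->] := strict_diff_differentiable hT.
  split=> [x /hf/strict_diff_differentiable[]//|x /set_mem Ux].
  apply/cvgrPdist_le => e e0.
  have e2 : 0 < e / 2 by rewrite divr_gt0.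
  have [r r0 rU] := open_ball oU Ux.
  have [d d0 hd] := hf x Ux _ e2.
  apply/nbhs_ballP; exists (Num.min r (d / 2)).
    by rewrite /= lt_min r0 divr_gt0.
  move=> p px.
  have pr : ball x r p by apply: le_ball px; rewrite ge_min lexx.
  have pd : ball x (d / 2) p by apply: le_ball px; rewrite ge_min lexx orbT.
  have [s s0 hs] := hf p (rU _ pr) _ e2.
  rewrite [e]splitr.
  apply: (@lip_mod_dist _ _ _ p (Num.min s (d / 2)) _ _ _ _ f f) => //.
  + by rewrite lt_min s0 divr_gt0.
  + lra.
  + apply: lip_modS hd => q pq; rewrite [d]splitr; apply: ball_triangle pd _.
    by apply: le_ball pq; rewrite ge_min lexx orbT.
  + by apply: lip_modS hs; apply: le_ball; rewrite ge_min lexx.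
Qed.

Lemma strict_diff_frechet U f x : C1s U f -> U x ->
  strict_diff f x (frechet f x).
Proof. by move=> h /h[T hT]; have [_ ->] := strict_diff_differentiable hT. Qed.

Lemma bounded_is_clinear (f : X -> Y) (K : R) :
  linear f -> (forall v, `|f v| <= K * `|v|) -> f \in @is_clinear R X Y.
Proof.
move=> lf fK; apply/is_clinearP; split=> // x.
have fB u v : f u - f v = f (u - v).
  by have := lf (-1) v u; rewrite !scaleN1r addrC => <-; rewrite addrC.
apply/cvgrPdist_lt => e e0; pose k := `|K| + 1.
have k0 : 0 < k by rewrite ltr_wpDl.
apply/nbhs_ballP; exists (e / k); first by rewrite /= divr_gt0.
move=> z; rewrite in_ballE ltr_pdivlMr// => xz /=; rewrite fB.
apply: le_lt_trans (fK _) _; apply: le_lt_trans xz; rewrite mulrC ler_wpM2l//.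
by rewrite (le_trans (ler_norm K))// lerDl.
Qed.

End C1.

(** * Norming functionals *)

Section HahnBanach.
Context {R : realType} {Y : normedModType R}.
Implicit Types (p q : Y -> R) (x y z : Y) (t : R).

Definition sublinear p := (forall x y, p (x + y) <= p x + p y) /\
  (forall t x, 0 < t -> p (t *: x) <= t * p x).

Lemma sublinearZ p t x : sublinear p -> 0 < t -> p (t *: x) = t * p x.
Proof.
move=> [_ pZ] t0; apply/le_anti; rewrite pZ//= -ler_pdivlMl//.
rewrite -[in leLHS](scalerK (lt0r_neq0 t0) x).
by apply: pZ; rewrite invr_gt0.
Qed.

Lemma sublinear0 p : sublinear p -> p 0 = 0.
Proof.
move=> sp; have := @sublinearZ p 2 0 sp ltac:(by []); rewrite scaler0; lra.
Qed.

Lemma sublinear_opp p x : sublinear p -> - p (- x) <= p x.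
Proof. by move=> sp; have := sp.1 x (- x); rewrite subrr sublinear0//; lra. Qed.

Lemma sublinear_norm : sublinear (fun x => `|x|).
Proof.
split=> [x y|t x t0]; first exact: ler_normD.
by rewrite normrZ gtr0_norm.
Qed.

(** The infimum of the translates of the graph of $p$ along the ray through
    $(x, p(x))$.  It is below $p$, and it is at most $-p(x)$ at $-x$, so that
    a minimal sublinear functional is odd, hence linear. *)
Definition tilt p x y :=
  inf [set p (y + t *: x) - t * p x | t in [set t | 0 <= t]].

Lemma tilt_lbound p x y : sublinear p ->
  lbound [set p (y + t *: x) - t * p x | t in [set t | 0 <= t]] (- p (- y)).
Proof.
move=> sp _ [t /= t0 <-].
have := sp.1 (y + t *: x) (- y); rewrite (_ : _ + _ - y = t *: x); last by zmod.
have [->|tn0] := eqVneq t 0; first by rewrite scale0r sublinear0// addr0; lra.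
by rewrite sublinearZ//; [lra|rewrite lt_neqAle eq_sym tn0].
Qed.

Lemma tilt_le p x y t : sublinear p -> 0 <= t ->
  tilt p x y <= p (y + t *: x) - t * p x.
Proof.
move=> sp t0; apply: ge_inf; last by exists t.
by exists (- p (- y)); exact: tilt_lbound.
Qed.

Lemma le_tilt p x y (c : R) :
  (forall t, 0 <= t -> c <= p (y + t *: x) - t * p x) -> c <= tilt p x y.
Proof.
move=> h; apply: lb_le_inf.
  by exists (p (y + 0 *: x) - 0 * p x), 0 => //=.
by move=> _ [t /= t0 <-]; exact: h.
Qed.

Lemma sublinear_tilt p x : sublinear p -> sublinear (tilt p x).
Proof.
move=> sp; split=> [y z|t y t0].
- rewrite -lerBlDr; apply: le_tilt => s s0.
  rewrite lerBlDr -lerBlDl; apply: le_tilt => t t0.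
  have := @tilt_le p x (y + z) (s + t) sp (addr_ge0 s0 t0).
  have := sp.1 (y + s *: x) (z + t *: x).
  have -> : y + s *: x + (z + t *: x) = y + z + (s + t) *: x.
    by rewrite scalerDl; zmod.
  nra.
- rewrite -ler_pdivrMl//; apply: le_tilt => s s0; rewrite ler_pdivrMl//.
  have := @tilt_le p x (t *: y) (t * s) sp (mulr_ge0 (ltW t0) s0).
  rewrite -scalerA -scalerDr (sublinearZ _ sp t0); nra.
Qed.

Lemma tilt_le_self p x y : sublinear p -> tilt p x y <= p y.
Proof.
by move=> sp; have := @tilt_le p x y 0 sp (lexx 0); rewrite scale0r addr0; lra.
Qed.

Lemma tilt_opp p x : sublinear p -> tilt p x (- x) <= - p x.
Proof.
move=> sp; have := @tilt_le p x (- x) 1 sp ler01.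
by rewrite scale1r addNr sublinear0//; lra.
Qed.

(** Zorn's lemma: the pointwise infimum of a chain of sublinear functionals is
    sublinear, and it is finite because $p(y)\ge -p(-y)\ge -q(-y)$. *)
Lemma minimal_sublinear q : sublinear q -> exists p, [/\ sublinear p,
  forall y, p y <= q y &
  forall r, sublinear r -> (forall y, r y <= p y) -> r = p].
Proof.
move=> sq; pose P p := sublinear p /\ forall y, p y <= q y.
pose le (p r : {p | P p}) := `[< forall y, sval r y <= sval p y >].
have [| | | |[p [sp pq]] pmin] := @Zorn {p | P p} le.
- by move=> p; apply/asboolP.
- move=> p r s /asboolP pr /asboolP rs; apply/asboolP => y.
  exact: le_trans (rs y) (pr y).
- move=> [p Pp] [r Pr] /asboolP /= pr /asboolP /= rp; apply: eq_exist.
  by apply/funext => y; apply/le_anti; rewrite pr rp.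
- move=> A totA; have [A0|/set0P[p0 Ap0]] := eqVneq A set0.
    by exists (exist _ q (conj sq (fun y => lexx _))) => s; rewrite A0.
  pose m y := inf [set sval p y | p in A].
  have lb y : lbound [set sval p y | p in A] (- q (- y)).
    move=> _ [[p [sp pq]] /= _ <-]; have := sublinear_opp y sp.
    by have := pq (- y); lra.
  have mle (p : {p | P p}) y : A p -> m y <= sval p y.
    by move=> Ap; apply: ge_inf; [exists (- q (- y))|exists p].
  have lem y c : (forall p : {p | P p}, A p -> c <= sval p y) -> c <= m y.
    move=> h; apply: lb_le_inf; first by exists (sval p0 y), p0.
    by move=> _ [p Ap <-]; exact: h.
  have sm : sublinear m.
    split=> [y z|t y t0].
      rewrite -lerBlDr; apply: (lem y) => p Ap; rewrite lerBlDr -lerBlDl.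
      apply: (lem z) => r Ar; rewrite lerBlDl.
      have [/asboolP pr|/asboolP rp] := totA _ _ Ap Ar.
        have [[sr _] _] := svalP r; have := sr y z; have := pr y.
        by have := mle r (y + z) Ar; lra.
      have [[sr _] _] := svalP p; have := sr y z; have := rp z.
      by have := mle p (y + z) Ap; lra.
    rewrite -ler_pdivrMl//; apply: (lem y) => p Ap; rewrite ler_pdivrMl//.
    by have [[_ pZ] _] := svalP p; exact: le_trans (mle p _ Ap) (pZ _ _ t0).
  have mq y : m y <= q y.
    by have [_ /(_ y)] := svalP p0; exact: le_trans (mle _ _ Ap0).
  exists (exist _ m (conj sm mq)) => p Ap; apply/asboolP => y /=; exact: mle.
exists p; split=> // r sr rp.
have rq y : r y <= q y by exact: le_trans (rp y) (pq y).
have := pmin (exist _ r (conj sr rq)) => /= h.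
by have /(congr1 sval)/= := h ltac:(by apply/asboolP).
Qed.

(** The Hahn--Banach theorem for one vector: a minimal sublinear functional
    below the norm tilted at $y$ is linear, and equals $\|y\|$ at $y$. *)
Lemma norming_functional y : exists phi : clinear Y R,
  phi y = `|y| /\ forall z, `|phi z| <= `|z|.
Proof.
have sn := sublinear_norm.
have [p [sp pq pmin]] := minimal_sublinear (sublinear_tilt y sn).
have odd x : p (- x) = - p x.
  apply/le_anti; rewrite lerNl; apply/andP; split; last first.
    by rewrite -lerNl; have := sublinear_opp x sp; lra.
  rewrite lerNr; have := pmin (tilt p x) (sublinear_tilt x sp).
  move=> /(_ (fun z => tilt_le_self x z sp)) tp.
  by have := tilt_opp x sp; rewrite tp; lra.
have addp u v : p (u + v) = p u + p v.
  apply/le_anti; rewrite sp.1 /=; have := sp.1 (u + v) (- v).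
  by rewrite addrK odd; lra.
have linp : linear p.
  move=> a u v; rewrite addp; congr (_ + _).
  have [a0|a0|->] := ltgtP a 0; last by rewrite !scale0r sublinear0.
    rewrite -[a in LHS]opprK scaleNr odd sublinearZ ?oppr_gt0//.
    by rewrite mulNr opprK.
  by rewrite sublinearZ.
have ple z : p z <= `|z| by apply: (le_trans (pq z)); exact: tilt_le_self.
have pn z : `|p z| <= `|z|.
  by rewrite ler_norml ple andbT lerNl -odd -normrN ple.
have cl : p \in @is_clinear R Y R.
  by apply: (@bounded_is_clinear _ _ _ _ 1) => // z; rewrite mul1r.
exists (CLinear cl); split; last exact: pn.
change (p y = `|y|); apply/le_anti; rewrite ple /=.
by have := tilt_opp y sn; have := pq (- y); rewrite odd; lra.
Qed.

End HahnBanach.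

(** * Smooth approximation on balls *)

Section ApproximationOnBalls.
Context {R : realType}.

Definition LA_on_balls (X Y : normedModType R) (C : R) :=
  forall (c : X) (r L : R) (f : X -> Y) (e : R), 0 < r -> 0 <= L -> 0 < e ->
  lip_mod (ball c r) 0 L f ->
  exists g, [/\ lip_mod (ball c r) 0 (C * L) g, C1s (ball c r) g &
    forall x, ball c r x -> `|f x - g x| <= e].

Lemma id_clinear_subproof (X : normedModType R) : id \in @is_clinear R X X.
Proof. by apply/is_clinearP; split=> // x; exact: cvg_id. Qed.

Definition id_clinear (X : normedModType R) : clinear X X :=
  CLinear (id_clinear_subproof X).

Lemma LA1_on_balls (X Y : normedModType R) (C : R) :
  property_LA1 X Y C -> LA_on_balls X Y C.
Proof.
move=> [C0 hLA] c r L f e r0 L0 e0 hf.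
have rn0 : r != 0 by rewrite gt_eqF.
have inball z : ball 0 1 z -> ball c r (c + r *: z).
  rewrite !in_ballE sub0r normrN opprD addrA subrr sub0r normrN normrZ.
  rewrite gtr0_norm//.
  by move=> z1; nra.
have [|g0 [gL gC gf]] := hLA (L * r) (fun z => f (c + r *: z)) e
    (mulr_ge0 L0 (ltW r0)) _ e0.
  apply/lip_mod0P => y z y1 z1; rewrite subr0.
  have := lip_mod0_norm hf (inball _ y1) (inball _ z1).
  have -> : c + r *: z - (c + r *: y) = r *: (z - y) by rewrite scalerBr; zmod.
  by rewrite normrZ gtr0_norm// mulrA.
pose a x := r^-1 *: (x - c).
have aball x : ball c r x -> ball 0 1 (a x).
  rewrite !in_ballE /a sub0r normrN normrZ gtr0_norm ?invr_gt0// ltr_pdivrMl//.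
  by rewrite mulr1 distrC.
exists (g0 \o a); split.
- move=> y z /aball y1 /aball z1; rewrite subr0.
  have -> : C * L * `|z - y| = C * (L * r) * `|a z - a y|.
    rewrite /a -scalerBr normrZ gtr0_norm ?invr_gt0//.
    have -> : z - c - (y - c) = z - y by zmod.
    by rewrite -!mulrA (mulrA r) divff// mul1r.
  by apply: lip_mod0_norm y1 z1; exact/lip_mod0P.
- move=> x /aball x1.
  have [S hS] := (C1_onP g0 (ball_open _ _)).1 gC (a x) x1.
  eexists; apply: (strict_diff_comp _ hS).
  apply: (@strict_diff_eq _ X X
    (clinear_fun (r^-1 *: id_clinear X) - cst (r^-1 *: c)) a x 1) => //.
    move=> y _; change (r^-1 *: y - r^-1 *: c = a y).
    by rewrite /a scalerBr.
  by apply: strict_diffB; [exact: strict_diff_clinear|exact: strict_diff_cst].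
- move=> x /aball /gf; rewrite /a scalerA divff// scale1r.
  by have -> : c + (x - c) = x by zmod.
Qed.

(** Multiply a real function by a unit vector, approximate, and come back by a
    functional of norm one that norms this vector. *)
Lemma LA_on_balls_scalar (X Y : normedModType R) (C : R) (y : Y) : y != 0 ->
  LA_on_balls X Y C -> LA_on_balls X R C.
Proof.
move=> yn0 h c r L u e r0 L0 e0 hu.
have ny : 0 < `|y| by rewrite normr_gt0.
pose y1 := `|y|^-1 *: y.
have ny1 : `|y1| = 1 by rewrite normrZ gtr0_norm ?invr_gt0// mulVf// gt_eqF.
have [phi [phi1 phile]] := norming_functional y1; rewrite ny1 in phi1.
have [|g [gL gC gu]] := h c r L (fun x => u x *: y1) e r0 L0 e0.
  move=> x z xr zr; rewrite subr0 -scalerBl normrZ ny1 mulr1.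
  exact: (lip_mod0_norm hu).
exists (phi \o g); split.
- move=> x z xr zr; rewrite subr0 /= -clinearB (le_trans (phile _))//.
  exact: (lip_mod0_norm gL).
- move=> x /gC[T hT]; eexists; apply: (strict_diff_comp hT).
  exact: strict_diff_clinear.
- move=> x /gu xe; apply: le_trans xe; apply: le_trans (phile _).
  by rewrite clinearB clinearZ phi1 /= [u x *: _]mulr1.
Qed.

End ApproximationOnBalls.

(** * Smooth bumps *)

Section Step.
Context {R : realType}.
Implicit Types a b t : R.

Definition locally_lip (X : normedModType R) (M : R) (u : X -> R) :=
  forall x, exists2 d : R, 0 < d & lip_mod (ball x d) 0 M u.

Definition pos_sq t : R := (Num.max 0 t) ^+ 2.

Lemma max0_lip a b : `|Num.max 0 a - Num.max 0 b| <= `|a - b|.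
Proof.
wlog ab : a b / a <= b => [h|].
  by have [/h//|/ltW/h] := leP a b; rewrite distrC (distrC b).
rewrite distrC (distrC a) !ger0_norm ?subr_ge0//; last first.
  by rewrite ge_max !le_max lexx /= ab orbT.
by rewrite /Num.max; have [?|?] := ltP 0 a; have [?|?] := ltP 0 b; lra.
Qed.

Lemma pos_sq_taylor a b :
  `|pos_sq b - pos_sq a - 2 * Num.max 0 a * (b - a)| <= (b - a) ^+ 2.
Proof.
have := sqr_ge0 (b - a); rewrite !expr2 /pos_sq /Num.max ler_norml => ?.
by have [?|?] := ltP 0 a; have [?|?] := ltP 0 b; apply/andP; split; nra.
Qed.

Lemma pos_sq_strict_diff t : exists T, strict_diff pos_sq t T.
Proof.
exists ((2 * Num.max 0 t) *: id_clinear R).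
apply: (@strict_diff_upto _ _ _ _ _ _ 6) => // e /andP[e0 e1].
exists e => // y z; rewrite !in_ballE => yt zt.
change (`|pos_sq z - pos_sq y - (2 * Num.max 0 t) * (z - y)|
  <= 6 * e * `|z - y|).
have By := max0_lip t y; have Bz := max0_lip z y.
have zy2 : `|z - y| <= 2 * e.
  have -> : z - y = (t - y) - (t - z) by zmod.
  by rewrite (le_trans (ler_normB _ _))//; lra.
pose p := Num.max 0 y; pose q := Num.max 0 z.
(* the derivative at t differs from the one at y by at most 2 e *)
have -> : pos_sq z - pos_sq y - 2 * Num.max 0 t * (z - y) =
   (pos_sq z - pos_sq y - 2 * p * (z - y)) + 2 * (p - Num.max 0 t) * (z - y).
  by ring.
have A : `|pos_sq z - pos_sq y - 2 * p * (z - y)| <= `|z - y| * `|z - y|.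
  rewrite -normrM -expr2 (ger0_norm (sqr_ge0 (z - y))).
  exact: pos_sq_taylor.
have B : `|2 * (p - Num.max 0 t) * (z - y)| <= 2 * e * `|z - y|.
  rewrite !normrM ler_wpM2r// gtr0_norm// ler_pM2l//.
  by rewrite distrC (le_trans By)// ltW.
rewrite (le_trans (ler_normD _ _))// (le_trans (lerD A B))//.
have := normr_ge0 (z - y); nra.
Qed.

(** A $C^1$ function equal to $1$ on the negative half-line and to $0$ beyond
    $1$. *)
Definition step t := pos_sq (1 - pos_sq t).

Lemma C1s_step : C1s setT step.
Proof.
move=> t _; have [T hT] := pos_sq_strict_diff t.
have [S hS] := pos_sq_strict_diff (1 - pos_sq t).
eexists; apply: (@strict_diff_comp _ _ _ _ pos_sq (cst 1 - pos_sq)) hS.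
by apply: strict_diffB hT; exact: strict_diff_cst.
Qed.

Lemma step1 t : t <= 0 -> step t = 1.
Proof.
move=> t0; rewrite /step /pos_sq (max_idPl t0) expr0n /= subr0.
by rewrite (max_idPr ler01) expr1n.
Qed.

Lemma step0 t : 1 <= t -> step t = 0.
Proof.
move=> t1; rewrite /step /pos_sq (max_idPr (le_trans ler01 t1)).
by rewrite (max_idPl _) ?expr0n//; nra.
Qed.

Lemma step_ge0 t : 0 <= step t.
Proof. exact: sqr_ge0. Qed.

Lemma step_le1 t : step t <= 1.
Proof.
rewrite /step /pos_sq; set a := Num.max 0 t ^+ 2.
have a0 : 0 <= a by exact: sqr_ge0.
by rewrite /Num.max; have [?|?] := ltP 0 (1 - a); nra.
Qed.

(** Clamping the argument to $[0,1]$ does not change the function, which is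
    $(1-p^2)^2$ for the clamped argument $p$. *)
Lemma step_lip a b : `|step a - step b| <= 4 * `|a - b|.
Proof.
pose p t := Num.min 1 (Num.max 0 t).
have p01 t : 0 <= p t <= 1.
  by rewrite /p le_min ler01 /= le_max lexx ge_min lexx.
have stepE t : step t = (1 - p t ^+ 2) ^+ 2.
  rewrite /p; have [t1|t1] := leP 1 t.
    by rewrite (step0 t1) (max_idPr (le_trans ler01 t1)) (min_idPl t1); ring.
  have m1 : Num.max 0 t <= 1 by rewrite ge_max ler01 ltW.
  rewrite (min_idPr m1) /step /pos_sq; congr (_ ^+ 2); apply/max_idPr.
  have m0 : 0 <= Num.max 0 t by rewrite le_max lexx.
  nra.
have pB : `|p a - p b| <= `|a - b|.
  apply: le_trans (max0_lip a b); rewrite /p.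
  wlog ab : a b / Num.max 0 a <= Num.max 0 b => [h|].
    by have [/h//|/ltW/h] := leP (Num.max 0 a) (Num.max 0 b);
      rewrite distrC (distrC (Num.max 0 b)).
  rewrite distrC (distrC (Num.max 0 a)) !ger0_norm ?subr_ge0//; last first.
    by rewrite le_min !ge_min lexx ab orbT.
  rewrite /Num.min; have [?|?] := ltP 1 (Num.max 0 a);
    have [?|?] := ltP 1 (Num.max 0 b); lra.
rewrite !stepE; move: (p01 a) (p01 b) pB; move: (p a) (p b) => x y x01 y01 xy.
have -> : (1 - x ^+ 2) ^+ 2 - (1 - y ^+ 2) ^+ 2 =
  (y - x) * ((x + y) * (2 - x ^+ 2 - y ^+ 2)) by ring.
rewrite normrM distrC mulrC ler_pM// ger0_norm.
- have : 0 <= (x + y) by lra.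
  have : x + y <= 2 by lra.
  by nra.
- by apply: mulr_ge0; nra.
Qed.

End Step.

Section Bump.
Context {R : realType} {X : normedModType R} (C : R) (C0 : 0 <= C).
Hypothesis hLA : LA_on_balls X R C.

Lemma dist_set_lip (E : set X) : E !=set0 ->
  exists u : X -> R, [/\ lip_mod setT 0 1 u,
    forall x y, E x -> u y <= `|x - y| &
    forall y r, (forall x, E x -> r <= `|x - y|) -> r <= u y].
Proof.
move=> [x0 Ex0]; pose u y := inf [set `|x - y| | x in E].
have lb y : has_lbound [set `|x - y| | x in E].
  by exists 0 => _ [x _ <-].
have ule x y : E x -> u y <= `|x - y|.
  by move=> Ex; apply: ge_inf => //; exists x.
have leu y r : (forall x, E x -> r <= `|x - y|) -> r <= u y.
  move=> h; apply: lb_le_inf; first by exists `|x0 - y|, x0.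
  by move=> _ [x Ex <-]; exact: h.
exists u; split=> // y z _ _; rewrite subr0 mul1r.
have uB v w : u v - u w <= `|v - w|.
  rewrite lerBlDr -lerBlDl; apply: leu => x Ex; rewrite lerBlDl.
  rewrite (le_trans (ule x v Ex))//.
  have -> : x - v = - (v - w) + (x - w) by zmod.
  by rewrite (le_trans (ler_normD _ _))// normrN.
by rewrite ler_norml uB andbT lerNl opprB distrC uB.
Qed.

(** Approximate the distance to $E$ within $s/20$, and apply to it a rescaled
    step going from $1$ at $s/10$ to $0$ at $3s/20$.  The approximation exists
    only on the ball, but the $s/5$-neighbourhood of $E$ keeps a positive
    distance from the complement of the ball, so that the function extends
    by $0$. *)
Lemma bump (E : set X) (c : X) (r s : R) : 0 < s ->
  (forall x, E x -> ball x s `<=` ball c r) ->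
  exists phi : X -> R, [/\ forall x, 0 <= phi x <= 1, C1s setT phi,
    locally_lip (80 * C / s) phi,
    forall x y, E x -> `|x - y| < s / 20 -> phi y = 1 &
    forall y, (forall x, E x -> s / 5 <= `|x - y|) -> phi y = 0].
Proof.
move=> s0 Ec; have M0 : 0 <= 80 * C / s by rewrite divr_ge0 ?mulr_ge0 ?(ltW s0).
have [->|/set0P E0] := eqVneq E set0.
  exists (cst 0); split=> //; first by move=> x; rewrite lexx ler01.
  - by move=> x _; exists 0; exact: strict_diff_cst.
  - by move=> x; exists 1 => //; apply: lip_mod_le M0 _; exact: lip_mod_cst.
have [x0 Ex0] := E0.
have r0 : 0 < r.
  have := Ec _ Ex0 _ (ballxx x0 s0); rewrite in_ballE; exact: le_lt_trans.
have [u [u1 ule leu]] := dist_set_lip E0.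
have s20 : 0 < s / 20 by lra.
have [v [vL vC vu]] := hLA r0 ler01 s20 (lip_modS (@subsetT _ (ball c r)) u1).
have vB y : ball c r y -> u y - s / 20 <= v y <= u y + s / 20.
  by move=> /vu; rewrite ler_norml => /andP[? ?]; apply/andP; split; lra.
pose a t := (s / 20)^-1 * (t - s / 10).
have aB t t' : a t - a t' = (s / 20)^-1 * (t - t') by rewrite /a; ring.
have is20 : 0 < (s / 20)^-1 by rewrite invr_gt0.
have a0 t : t <= s / 10 -> a t <= 0.
  by move=> ht; rewrite /a pmulr_rle0//; lra.
have a1 t : s / 10 + s / 20 <= t -> 1 <= a t.
  by move=> ht; rewrite /a ler_pdivlMl//; lra.
pose phi y := if `|c - y| < r then step (a (v y)) else 0.
have phi_in y : ball c r y -> phi y = step (a (v y)).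
  by rewrite in_ballE /phi => ->.
have phi_far y : (forall x, E x -> s / 5 <= `|x - y|) -> phi y = 0.
  move=> /leu uy; rewrite /phi; case: ifP => // yr; apply: step0.
  have /andP[? _] := vB y (eq_ind_r id yr (in_ballE c r y)).
  by apply: a1; lra.
have outside y : ~ ball c r y -> forall w, ball y (s / 2) w -> phi w = 0.
  move=> yr w; rewrite in_ballE => yw; apply: phi_far => x Ex.
  have : ~~ (`|x - y| < s).
    by apply/negP => xy; apply: yr; apply: (Ec x Ex); rewrite in_ballE.
  have : `|x - y| <= `|x - w| + `|y - w|.
    have -> : x - y = (x - w) - (y - w) by zmod.
    exact: ler_normB.
  rewrite -leNgt; lra.
exists phi; split=> //.
- move=> x; rewrite /phi; case: ifP => _; last by rewrite lexx ler01.
  by rewrite step_ge0 step_le1.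
- move=> y _; have [yr|yr] := pselect (ball c r y); last first.
    exists 0; apply: (@strict_diff_eq _ X R (cst 0) _ _ (s / 2)).
    + by rewrite divr_gt0.
    + by move=> w /(outside _ yr) ->.
    + exact: strict_diff_cst.
  have [d d0 dr] := open_ball (ball_open c r) yr.
  have [T hT] := vC _ yr; have [S hS] := C1s_step (I : setT (a (v y))).
  pose A := (s / 20)^-1 *: id_clinear R.
  have hA : strict_diff a (v y) (A - 0).
    apply: (@strict_diff_eq _ R R (clinear_fun A - cst ((s / 20)^-1 * (s / 10)))
      a _ 1) => //; last first.
      apply: strict_diffB; last exact: strict_diff_cst.
      exact: strict_diff_clinear.
    move=> w _; rewrite /a mulrBr.
    by change ((s / 20)^-1 * w - (s / 20)^-1 * (s / 10) =
      (s / 20)^-1 * w - (s / 20)^-1 * (s / 10)).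
  have hS' := strict_diff_comp (strict_diff_comp hT hA) hS.
  eexists; apply: (strict_diff_eq d0 _ hS') => w /dr /phi_in phiw.
  by rewrite phiw.
- move=> y; have [yr|yr] := pselect (ball c r y); last first.
    exists (s / 2); first by rewrite divr_gt0.
    move=> w z /(outside _ yr) -> /(outside _ yr) ->.
    by rewrite subrr subr0 normr0 mulr_ge0.
  have [d d0 dr] := open_ball (ball_open c r) yr.
  exists d => // w z /dr wr /dr zr; rewrite subr0 !phi_in//.
  rewrite (le_trans (step_lip _ _))// aB normrM gtr0_norm//.
  have := lip_mod0_norm vL wr zr; rewrite mulr1 => vzw.
  have -> : 80 * C / s * `|z - w| = 4 * ((s / 20)^-1 * (C * `|z - w|)).
    by field; rewrite gt_eqF.
  by rewrite !ler_pM2l.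
- move=> x y Ex xy; have yr : ball c r y.
    by apply: (Ec x Ex); rewrite in_ballE; lra.
  rewrite phi_in// step1// a0//; have /andP[_] := vB _ yr.
  by have := ule x y Ex; lra.
Qed.
End Bump.

(** * Partitions of unity *)

Section LocallyLip.
Context {R : realType} {X : normedModType R}.
Implicit Types (u v : X -> R) (k l d e : R).

Lemma ball_minl (x : X) d e : ball x (Num.min d e) `<=` ball x d.
Proof. by apply: le_ball; rewrite ge_min lexx. Qed.

Lemma ball_minr (x : X) d e : ball x (Num.min d e) `<=` ball x e.
Proof. by apply: le_ball; rewrite ge_min lexx orbT. Qed.

Lemma locally_lip_cst k (c : R) : 0 <= k -> locally_lip (X := X) k (cst c).
Proof.
by move=> k0 x; exists 1 => //; apply: lip_mod_le k0 _; exact: lip_mod_cst.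
Qed.

Lemma locally_lipM k l u v : (forall x, 0 <= u x <= 1) ->
  (forall x, 0 <= v x <= 1) -> locally_lip k u -> locally_lip l v ->
  locally_lip (k + l) (fun x => u x * v x).
Proof.
move=> u01 v01 hu hv x; have [d d0 hd] := hu x; have [e e0 he] := hv x.
exists (Num.min d e); first by rewrite lt_min d0.
move=> y z xy xz; rewrite subr0.
have := lip_mod0_norm hd (ball_minl xy) (ball_minl xz).
have := lip_mod0_norm he (ball_minr xy) (ball_minr xz).
have -> : u z * v z - u y * v y = u z * (v z - v y) + v y * (u z - u y) by ring.
move=> A B; rewrite (le_trans (ler_normD _ _))// !normrM addrC mulrDl.
have [/andP[u0 u1] /andP[v0 v1]] := (u01 z, v01 y).
rewrite (ger0_norm u0) (ger0_norm v0).
have := normr_ge0 (v z - v y); have := normr_ge0 (u z - u y).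
by move=> ? ?; apply: lerD; [apply: le_trans B|apply: le_trans A];
  rewrite ler_piMl.
Qed.

Lemma C1sM U u v : C1s U u -> C1s U v -> C1s U (fun x => u x * v x).
Proof.
move=> hu hv x Ux; have [S hS] := hu x Ux; have [T hT] := hv x Ux.
by eexists; exact: (strict_diffZ hS hT).
Qed.

End LocallyLip.

Lemma well_order_Prop (T : eqType) : exists le : T -> T -> Prop,
  [/\ forall i j, le i j \/ le j i, forall i j, le i j -> le j i -> i = j &
   forall P : set T, P !=set0 -> exists2 i, P i & forall j, P j -> le i j].
Proof.
have [r wo] := wochoice.well_ordering_principle T.
have least (P : set T) : P !=set0 -> exists2 i, P i & forall j, P j -> r i j.
  move=> [x Px]; have [|z [[Pz zmin] _]] := wo (fun y => `[< P y >]).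
    by exists x; apply/asboolP.
  exists z; first exact/asboolP.
  by move=> j Pj; apply: zmin; apply/asboolP.
exists r; split=> //.
- move=> i j; have [|k [] -> h] := least [set i; j]; first by exists i; left.
    by left; apply: h; right.
  by right; apply: h; left.
- move=> i j ij ji; have [|z [_ zuniq]] := wo (fun y => `[< y = i \/ y = j >]).
    by exists i; apply/asboolP; left.
  have rr k : r k k.
    have [|z' -> h] := least [set k]; first by exists k.
    exact: h.
  rewrite -(zuniq i) ?(zuniq j)//; split.
  + by apply/asboolP; right.
  + by move=> k /asboolP[] ->.
  + by apply/asboolP; left.
  + by move=> k /asboolP[] ->.
Qed.

Section DiscreteRefinement.
Context {R : realType} {X : normedModType R}.

Definition scale_of (n : nat) : R := 2^-1 ^+ n.

Lemma scale_of_gt0 n : 0 < scale_of n.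
Proof. by rewrite exprn_gt0. Qed.

Lemma scale_of_small (r : R) : 0 < r -> exists n, scale_of n < r.
Proof.
move=> r0; have : 2^-1 ^+ n @[n --> \oo] --> (0 : R).
  by apply: cvg_expr; rewrite ger0_norm//; lra.
move=> /cvgrPdist_lt/(_ r r0) [n _ /(_ n (leqnn n))].
by rewrite sub0r normrN ger0_norm ?exprn_ge0//; exists n.
Qed.

(** A variant of the device by which M. E. Rudin proves that metric spaces are
    paracompact: well-order the index set; the layer $n$ keeps, for each $i$, the
    points whose $2^{-n}$-ball lies in the ball of $i$ while their
    $2^{-n-1}$-ball lies in no earlier one.  Two such sets in the same layer are
    then at distance at least $2^{-n-1}$, and a point belongs to some layer of
    the first ball that contains it. *)
Lemma discrete_refinement (S : set X) (r : X -> R) :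
  exists E : nat -> X -> set X,
  [/\ forall n i x, E n i x -> S i /\ ball x (scale_of n) `<=` ball i (r i),
      forall n i j x y, E n i x -> E n j y -> i <> j ->
        scale_of n / 2 <= `|x - y| &
      forall x, (exists2 i, S i & ball i (r i) x) -> exists n i, E n i x].
Proof.
have [le [total anti wo]] := well_order_Prop X.
pose U i := ball i (r i).
exists (fun n i => [set x | [/\ S i, ball x (scale_of n) `<=` U i &
  forall j, S j -> j <> i -> le j i -> ~ (ball x (scale_of n / 2) `<=` U j)]]).
split=> [n i x []//|n i j x y Eix Ejy ij|x xS].
- wlog leij : i j x y Eix Ejy ij / le i j => [h|].
    have [/h|/h] := total i j; first exact.
    by rewrite distrC; apply=> //; exact: nesym.
  rewrite leNgt; apply/negP => xy.
  have [Si xi _] := Eix; have [_ _ /(_ i Si ij leij)] := Ejy; apply.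
  apply: subset_trans xi => z yz; rewrite [scale_of n]splitr.
  by apply: ball_triangle yz; rewrite in_ballE.
- have [|i [Si xi] imin] := wo [set i | S i /\ U i x].
    by have [i] := xS; exists i.
  have [d d0 dU] := open_ball (ball_open i (r i)) xi.
  have [n nd] := scale_of_small d0.
  exists n, i; split=> //; first by apply: subset_trans dU; exact/le_ball/ltW.
  move=> j Sj ji leji jx; apply: ji; apply: anti => //; apply: imin; split=> //.
  by apply: jx; apply: ballxx; rewrite divr_gt0 ?scale_of_gt0.
Qed.

End DiscreteRefinement.

Section Partition.
Context {R : realType} {X : normedModType R}.
Variables (S : set X) (r : X -> R).

(** Near $y$, the map $g$ is a finite convex combination of the pieces
    $h_{n,i_n}$, one for each layer $n<N$ that satisfies $Q$, and the ball on
    which this holds lies in the domains of all these pieces. *)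
Definition locally_glued (Y : normedModType R) (psi : nat -> X -> R)
    (M : nat -> R) (h : nat -> X -> X -> Y) (g : X -> Y) (y : X) :=
  exists (d : R) (N : nat) (Q : pred nat) (i : nat -> X), [/\ 0 < d,
    forall n, (n < N)%N -> Q n ->
      [/\ S (i n), ball y d `<=` ball (i n) (r (i n)) &
          lip_mod (ball y d) 0 (M n) (psi n)],
    forall x, ball y d x -> \sum_(n < N | Q n) psi n x = 1 &
    forall x, ball y d x -> g x = \sum_(n < N | Q n) psi n x *: h n (i n) x].

Lemma common_radius (P : nat -> R -> Prop) N :
  (forall n d e, e <= d -> P n d -> P n e) ->
  (forall n, (n < N)%N -> exists2 d : R, 0 < d & P n d) ->
  exists2 d : R, 0 < d & forall n, (n < N)%N -> P n d.
Proof.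
move=> Ple; elim: N => [|N IH] h; first by exists 1.
have [|d d0 hd] := IH; first by move=> n nN; apply: h; exact: ltnW.
have [e e0 he] := h N (ltnSn N).
exists (Num.min d e); first by rewrite lt_min d0.
move=> n; rewrite ltnS leq_eqVlt => /orP[/eqP ->|nN].
  by apply: Ple he; rewrite ge_min lexx orbT.
by apply: Ple (hd n nN); rewrite ge_min lexx.
Qed.

Lemma sum_head (V : zmodType) (F : nat -> V) (m N : nat) : (m <= N)%N ->
  (forall n, (m <= n)%N -> F n = 0) -> \sum_(n < N) F n = \sum_(n < m) F n.
Proof.
move=> mN F0; rewrite -!(big_mkord xpredT F) (@big_cat_nat _ _ _ m)//=.
rewrite (_ : \sum_(m <= i < N) F i = 0) ?addr0//.
by rewrite big_nat_cond big1// => n /andP[/andP[mn _] _]; exact: F0.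
Qed.

Context (C : R) (C0 : 0 <= C) (hLA : LA_on_balls X R C).

(** One function for each layer.  Bumps of one layer have separated supports,
    hence around each point at most one of them is active; idx picks it. *)
Lemma layered_bumps : exists phi : nat -> X -> R,
  exists idx : nat -> X -> X,
  [/\ forall n x, 0 <= phi n x <= 1, forall n, C1s setT (phi n),
      forall n, locally_lip (80 * C / scale_of n) (phi n),
      forall n y, exists2 d : R, 0 < d &
        (forall x, ball y d x -> phi n x = 0) \/
        exists i, [/\ S i, ball y d `<=` ball i (r i) &
          forall x, ball y d x -> phi n x != 0 -> idx n x = i] &
      forall y, (exists2 i, S i & ball i (r i) y) ->
        exists n, exists2 d : R, 0 < d & forall x, ball y d x -> phi n x = 1].
Proof.
have [E [ES Esep Ecov]] := discrete_refinement S r.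
have sp n := @scale_of_gt0 R n.
have /choice[u hu] : forall ni : nat * X, exists u : X -> R,
   [/\ forall x, 0 <= u x <= 1, C1s setT u,
    locally_lip (80 * C / scale_of ni.1) u,
    forall x y, E ni.1 ni.2 x -> `|x - y| < scale_of ni.1 / 20 -> u y = 1 &
    forall y, (forall x, E ni.1 ni.2 x -> scale_of ni.1 / 5 <= `|x - y|) ->
      u y = 0].
  by move=> ni; apply: (bump C0 hLA (sp ni.1)) => x /ES[_]; exact.
have near n i y : u (n, i) y != 0 ->
    exists2 x, E n i x & `|x - y| < scale_of n / 5.
  move=> uy; apply: contrapT => far; move/eqP: uy; apply.
  have [_ _ _ _] := hu (n, i); apply=> x Ex; rewrite leNgt; apply/negP => xy.
  by apply: far; exists x.
(* the supports of the bumps of one layer are at distance scale_of n / 10 of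
   each other *)
have single n y : exists i, forall x j, ball y (scale_of n / 20) x ->
    u (n, j) x != 0 -> j = i.
  have [[i [z [zy uz]]]|none] := pselect (exists i z,
      ball y (scale_of n / 20) z /\ u (n, i) z != 0); last first.
    exists y => x j xy ux; exfalso; apply: none; exists j, x; split=> //.
  exists i => x j xy ux; apply: contrapT => ji.
  have [a Ea az] := near _ _ _ uz; have [b Eb bx] := near _ _ _ ux.
  have := Esep _ _ _ _ _ Eb Ea ji.
  have -> : b - a = (b - x) - (a - z) - (y - x) + (y - z) by zmod.
  move: xy zy; rewrite !in_ballE => xy zy.
  have := ler_normD (b - x - (a - z) - (y - x)) (y - z).
  have := ler_normB (b - x - (a - z)) (y - x).
  have := ler_normB (b - x) (a - z).
  by have := sp n; lra.
pose idx n x := xget 0 [set i | u (n, i) x != 0].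
pose phi n x := u (n, idx n x) x.
have phiE n y i : (forall x j, ball y (scale_of n / 20) x ->
    u (n, j) x != 0 -> j = i) ->
    forall x, ball y (scale_of n / 20) x ->
      phi n x = u (n, i) x /\ (phi n x != 0 -> idx n x = i).
  move=> hi x xy; rewrite /phi.
  have [idx0|idxn0] := eqVneq (u (n, idx n x) x) 0.
    split; last by [].
    rewrite idx0; have [//|uin0] := eqVneq (u (n, i) x) 0.
    have : [set i | u (n, i) x != 0] (idx n x) by apply: xgetPex; exists i.
    by rewrite /= idx0 eqxx.
  by have -> := hi _ _ xy idxn0.
exists phi, idx; split.
- by move=> n x; have [h _ _ _ _] := hu (n, idx n x); exact: h.
- move=> n y _; have [i hi] := single n y.
  have [_ /(_ y I)[T hT] _ _ _] := hu (n, i); exists T.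
  apply: (@strict_diff_eq _ _ _ (u (n, i)) _ _ (scale_of n / 20)) => //.
    by rewrite divr_gt0.
  by move=> x /(phiE n y i hi)[].
- move=> n y; have [i hi] := single n y.
  have [_ _ /(_ y)[d d0 hd] _ _] := hu (n, i).
  exists (Num.min d (scale_of n / 20)); first by rewrite lt_min d0 divr_gt0.
  apply: (@eq_lip_mod _ _ _ _ _ _ (u (n, i))).
    by move=> x /ball_minr /(phiE n y i hi)[].
  exact: (lip_modS (@ball_minl _ _ _ _ _)) hd.
- move=> n y; have [i hi] := single n y.
  have s20 : 0 < scale_of n / 20 :> R by rewrite divr_gt0.
  have s2 : 0 < scale_of n / 2 :> R by rewrite divr_gt0.
  have [[Si iy]|out] := pselect (S i /\ ball i (r i) y).
    have [d d0 dr] := open_ball (ball_open i (r i)) iy.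
    exists (Num.min d (scale_of n / 20)); first by rewrite lt_min d0.
    right; exists i; split=> //.
      by apply: subset_trans dr; exact: ball_minl.
    by move=> x /ball_minr /(phiE n y i hi)[].
  exists (Num.min (scale_of n / 2) (scale_of n / 20)).
    by rewrite lt_min s2.
  left=> x xy; have [-> _] := phiE n y i hi x (ball_minr xy).
  apply/eqP; apply: contrapT => /negP /near[e /ES[Si eU] ex].
  apply: out; split=> //; apply: eU; rewrite in_ballE.
  move: (ball_minl xy); rewrite in_ballE => yx.
  have -> : e - y = (e - x) - (y - x) by zmod.
  by have := ler_normB (e - x) (y - x); have := sp n; lra.
- move=> y /Ecov[n [i Ey]]; exists n.
  have s20 : 0 < scale_of n / 20 :> R by rewrite divr_gt0.
  exists (scale_of n / 20) => // x xy.
  have u1 : u (n, i) x = 1.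
    have [_ _ _ h _] := hu (n, i); apply: (h y) => //.
    by move: xy; rewrite in_ballE.
  have [j hj] := single n y; have [-> _] := phiE n y j hj x xy.
  by rewrite -(hj x i)// u1 oner_neq0.
Qed.

(** The usual trick for making a sequence of bumps add up to $1$: with
    $\psi_n=\phi_n\prod_{m<n}(1-\phi_m)$ the partial sums are
    $1-\prod_{m<N}(1-\phi_m)$, and all the terms after the first $n$ with
    $\phi_n=1$ vanish.  The Lipschitz bound $M_n$ depends on the layer only,
    so that the precision of the pieces to be glued can be chosen in
    advance. *)
Lemma C1_partition : exists psi : nat -> X -> R, exists M : nat -> R,
  [/\ forall n x, 0 <= psi n x, forall n, C1s setT (psi n),
      forall n, 0 <= M n &
      forall (Y : normedModType R) (h : nat -> X -> X -> Y),
      exists g, forall y, (exists2 i, S i & ball i (r i) y) ->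
        locally_glued psi M h g y].
Proof.
have [phi [idx [phi01 phiC phiL phiS phi1]]] := layered_bumps.
pose P n x := \prod_(m < n) (1 - phi m x).
have P01 n x : 0 <= P n x <= 1.
  rewrite /P; elim: n => [|n IH]; first by rewrite big_ord0 ler01 lexx.
  rewrite big_ord_recr /=; have := phi01 n x.
  move: IH => /andP[? ?] /andP[? ?].
  by rewrite mulr_ge0 ?mulr_ile1 ?subr_ge0//; lra.
pose K n : R := 80 * C / scale_of n.
have K0 n : 0 <= K n by rewrite /K divr_ge0 ?mulr_ge0 ?(ltW (scale_of_gt0 _)).
pose MP n : R := \sum_(m < n) K m.
have PC n : C1s setT (P n) /\ locally_lip (MP n) (P n).
  elim: n => [|n [IH1 IH2]].
    have PE : P 0%N = cst 1 by apply/funext => x; rewrite /P big_ord0.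
    rewrite PE /MP big_ord0; split; last exact: locally_lip_cst.
    by move=> x _; exists 0; exact: strict_diff_cst.
  have PE : P n.+1 = fun x => P n x * (1 - phi n x).
    by apply/funext => x; rewrite /P big_ord_recr.
  have phiC' : C1s setT (cst 1 - phi n).
    move=> x _; have [T hT] := phiC n x I; eexists.
    by apply: strict_diffB hT; exact: strict_diff_cst.
  rewrite PE /MP big_ord_recr; split; first exact: (C1sM IH1 phiC').
  apply: locally_lipM => //.
    by move=> x; have := phi01 n x; lra.
  move=> x; have [d d0 hd] := phiL n x; exists d => //.
  have := lip_modB (@lip_mod_cst _ _ _ (ball x d) (1 : R)) hd.
  by rewrite subr0 add0r.
pose psi n x := P n x * phi n x.
have sumpsi N x : \sum_(n < N) psi n x = 1 - P N x.
  elim: N => [|N IH]; first by rewrite /P !big_ord0 subrr.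
  by rewrite big_ord_recr /= IH /psi /P [in RHS]big_ord_recr /=; ring.
exists psi, (fun n => MP n + K n); split.
- move=> n x; have /andP[? _] := P01 n x; have /andP[? _] := phi01 n x.
  exact: mulr_ge0.
- by move=> n; exact: (C1sM (PC n).1 (phiC n)).
- by move=> n; rewrite addr_ge0// sumr_ge0.
move=> Y h.
(* tail x bounds the layers that do not vanish at x *)
pose tail x := xget 0%N [set N | forall n, (N <= n)%N -> psi n x = 0].
pose g x := \sum_(n < tail x) psi n x *: h n (idx n x) x.
exists g => y ySr.
have [n0 [d0 d00 phi_one]] := phi1 y ySr.
have Pvanish n x : (n0 < n)%N -> ball y d0 x -> P n x = 0.
  move=> n0n /phi_one phix; rewrite /P (bigD1 (Ordinal n0n))//= phix subrr.
  by rewrite mul0r.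
have psi_vanish n x : (n0 < n)%N -> ball y d0 x -> psi n x = 0.
  by move=> n0n xy; rewrite /psi Pvanish// mul0r.
have gE x : ball y d0 x -> g x = \sum_(n < n0.+1) psi n x *: h n (idx n x) x.
  move=> xy; have tailP : forall n, (tail x <= n)%N -> psi n x = 0.
    have : [set N | forall n, (N <= n)%N -> psi n x = 0] (tail x).
      by apply: xgetPex; exists n0.+1 => n n0n; exact: psi_vanish.
    by [].
  pose F n := psi n x *: h n (idx n x) x.
  rewrite /g; have [le|/ltnW le] := leqP (tail x) n0.+1.
    rewrite [RHS](@sum_head _ F (tail x))// => n /tailP.
    by rewrite /F => ->; rewrite scale0r.
  rewrite [LHS](@sum_head _ F n0.+1)// => n n0n.
  by rewrite /F psi_vanish// scale0r.
(* a layer whose bump vanishes near y is left out of the local sum, so that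
   the other ones have their pieces defined around y *)
pose dropped n d := forall x, ball y d x -> phi n x = 0.
pose kept n d i := [/\ S i, ball y d `<=` ball i (r i) &
  forall x, ball y d x -> phi n x != 0 -> idx n x = i].
pose L n d := lip_mod (ball y d) 0 (MP n + K n) (psi n).
have [||d d0' hd] := @common_radius
    (fun n d => (dropped n d \/ exists i, kept n d i) /\ L n d) n0.+1.
- move=> n d e /(@le_ball _ _ y) ed [H1 H2]; split; last exact: lip_modS H2.
  case: H1 => [h0|[i [Si iU hi]]].
    by left=> x /ed; exact: h0.
  right; exists i; split=> //; first exact: subset_trans iU.
  by move=> x /ed; exact: hi.
- move=> n _; have [a a0 ha] := phiS n y.
  have [b b0 hb] := locally_lipM (P01 n) (phi01 n) (PC n).2 (phiL n) y.
  exists (Num.min a b); first by rewrite lt_min a0.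
  split; last exact: lip_modS (@ball_minr _ _ _ _ _) hb.
  case: ha => [h0|[i [Si iU hi]]].
    by left=> x /ball_minl; exact: h0.
  right; exists i; split=> //; last by move=> x /ball_minl; exact: hi.
  exact: subset_trans (@ball_minl _ _ _ _ _) iU.
pose D := Num.min d d0.
have D0 : 0 < D by rewrite lt_min d0'.
have /choice[i hi] : forall n, exists i, (exists i, kept n D i) -> kept n D i.
  move=> n; have [[i hi]|no] := pselect (exists i, kept n D i).
    by exists i.
  by exists y.
pose Q n := `[< exists i, kept n D i >].
have psi_dropped n x : (n < n0.+1)%N -> ~~ Q n -> ball y D x -> psi n x = 0.
  move=> nN /asboolPn nQ xD; rewrite /psi.
  have [[phi0|[j [Sj jU hj]]] _] := hd n nN.
    by rewrite phi0 ?mulr0//; exact: ball_minl xD.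
  exfalso; apply: nQ; exists j; split=> //.
    exact: subset_trans (@ball_minl _ _ _ _ _) jU.
  by move=> z /ball_minl; exact: hj.
exists D, n0.+1, Q, i; split=> //.
- move=> n nN /asboolP/hi[Si iU _]; split=> //.
  by have [_] := hd n nN; apply: lip_modS; exact: ball_minl.
- move=> x xD; rewrite big_mkcond /=.
  rewrite (eq_bigr (fun n : 'I_n0.+1 => psi n x)) ?sumpsi.
    by rewrite Pvanish ?subr0//; exact: ball_minr xD.
  by move=> n _; case: ifPn => // /psi_dropped ->.
- move=> x xD; rewrite gE; last exact: ball_minr xD.
  rewrite [RHS]big_mkcond; apply: eq_bigr => n _; case: ifPn => [|nQ].
    move=> /asboolP/hi[_ _ hin].
    have [phi0|/(hin _ xD) -> //] := eqVneq (phi n x) 0.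
    by rewrite /psi phi0 mulr0 !scale0r.
  by rewrite psi_dropped// scale0r.
Qed.

End Partition.

(** * Estimates for glued maps *)

Section Gluing.
Context {R : realType} {X Y : normedModType R}.
Implicit Types (U : set X) (T : clinear X Y) (f g : X -> Y).

(** Since the weights add up to $1$, their increments add up to $0$, so that
    $g(z)-g(y)-T(z-y)$ is
    $\sum_n \psi_n(z)(k_n(z)-k_n(y)-T(z-y))
     + \sum_n (\psi_n(z)-\psi_n(y))(k_n(y)-c(y))$
    for any choice of $c(y)$. *)
Lemma glue_lip_mod U T (N : nat) (Q : pred nat) (psi : nat -> X -> R)
    (k : nat -> X -> Y) (M m : nat -> R) (l e : R) (c g : X -> Y) :
  (forall n x, 0 <= psi n x) ->
  (forall x, U x -> \sum_(n < N | Q n) psi n x = 1) ->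
  (forall n, (n < N)%N -> Q n -> lip_mod U 0 (M n) (psi n)) ->
  (forall n, (n < N)%N -> Q n -> lip_mod U T l (k n)) ->
  (forall n x, (n < N)%N -> Q n -> U x -> `|k n x - c x| <= m n) ->
  \sum_(n < N | Q n) M n * m n <= e ->
  (forall x, U x -> g x = \sum_(n < N | Q n) psi n x *: k n x) ->
  lip_mod U T (l + e) g.
Proof.
move=> psi0 psi1 psiM kT kc Mm gE y z Uy Uz.
pose A := \sum_(n < N | Q n) psi n z *: (k n z - k n y - T (z - y)).
pose B := \sum_(n < N | Q n) (psi n z - psi n y) *: (k n y - c y).
pose D := \sum_(n < N | Q n) (psi n z - psi n y) *: c y.
have D0 : D = 0 by rewrite /D -scaler_suml sumrB !psi1// subrr scale0r.
have -> : g z - g y - T (z - y) = A + B.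
  rewrite -[RHS]addr0 -D0 !gE// -[T (z - y)]scale1r -(psi1 z Uz) scaler_suml.
  rewrite /A /B /D -!sumrB -!big_split /=; apply: eq_bigr => n _.
  by rewrite !(scalerBl, scalerBr); zmod.
have nA : `|A| <= l * `|z - y|.
  rewrite -[l * _]mul1r -(psi1 z Uz) mulr_suml.
  rewrite (le_trans (ler_norm_sum _ _ _))//; apply: ler_sum => n Qn.
  by rewrite normrZ ger0_norm// ler_wpM2l//; exact: kT.
have nB : `|B| <= e * `|z - y|.
  apply: (@le_trans _ _ (\sum_(n < N | Q n) M n * m n * `|z - y|)); last first.
    by rewrite -mulr_suml ler_wpM2r.
  rewrite (le_trans (ler_norm_sum _ _ _))//; apply: ler_sum => n Qn.
  rewrite normrZ mulrAC ler_pM//; last exact: kc.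
  by apply: (lip_mod0_norm (psiM _ _ Qn)).
by rewrite mulrDl (le_trans (ler_normD _ _))// lerD.
Qed.

Lemma glue_dist (N : nat) (Q : pred nat) (psi : nat -> R) (k : nat -> Y)
    (c : Y) (e : R) : (forall n, 0 <= psi n) ->
  \sum_(n < N | Q n) psi n = 1 ->
  (forall n, (n < N)%N -> Q n -> `|c - k n| <= e) ->
  `|c - \sum_(n < N | Q n) psi n *: k n| <= e.
Proof.
move=> psi0 psi1 kc.
rewrite -[c]scale1r -psi1 scaler_suml -sumrB -[e]mul1r -psi1 mulr_suml.
rewrite (le_trans (ler_norm_sum _ _ _))//; apply: ler_sum => n Qn.
by rewrite -scalerBr normrZ ger0_norm// ler_wpM2l//; exact: kc.
Qed.

Lemma LA_on_balls_mod C (c : X) r T l f e : LA_on_balls X Y C ->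
  0 < r -> 0 <= l -> 0 < e -> lip_mod (ball c r) T l f ->
  exists g, [/\ lip_mod (ball c r) T (C * l) g, C1s (ball c r) g &
    forall x, ball c r x -> `|f x - g x| <= e].
Proof.
move=> h r0 l0 e0 hf.
have hfT : lip_mod (ball c r) 0 l (f - T).
  have := lip_modB hf (@lip_mod_clinear _ _ _ (ball c r) T).
  by rewrite subrr addr0.
have [g [gL gC fg]] := h _ _ _ _ _ r0 l0 e0 hfT.
exists (g + T); split.
- have := lip_modD gL (@lip_mod_clinear _ _ _ (ball c r) T).
  by rewrite add0r addr0.
- move=> x /gC[S hS]; exists (S + T).
  by apply: strict_diffD hS _; exact: strict_diff_clinear.
- move=> x /fg; congr (`|_| <= _).
  by change (f x - T x - g x = f x - (g x + T x)); zmod.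
Qed.

End Gluing.

Lemma within_continuous_ballP (R : realType) (X Z : normedModType R) (A : set X)
    (G : X -> Z) : {within A, continuous G} <->
  forall a, A a -> forall e : R, 0 < e -> exists2 d : R, 0 < d &
    forall x, A x -> ball a d x -> `|G a - G x| <= e.
Proof.
rewrite subspace_continuousP; split=> h a Aa.
  move=> e e0; have /cvgrPdist_le/(_ e e0) := h a Aa.
  move=> /nbhs_ballP[d /= d0 hd]; exists d => // x Ax /hd; exact.
apply/cvgrPdist_le => e e0; have [d d0 hd] := h a Aa e e0.
by apply/nbhs_ballP; exists d => // x xd Ax; exact: hd.
Qed.

(** * Extension of f with control near A *)

Section NearExtension.
Context {R : realType} {X Y : normedModType R} (C : R).
Hypotheses (C0 : 0 <= C) (hLE : property_LE X Y C) (hLA : LA_on_balls X R C).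
Variables (A : set X) (f : X -> Y) (G : X -> clinear X Y) (L : R).
Hypotheses (L0 : 0 <= L) (hf : lip_mod A 0 L f)
  (hG : forall a, A a -> `|G a| <= L).

(** Near $a$ the map $f-G(a)$ is $\varepsilon$-Lipschitz on $A$, so that
    property (LE) gives an extension of $f$ which differs from $G(a)$ by a map
    with a small Lipschitz constant. *)
Lemma local_extension (a : X) (e : R) : condition_W A f G -> A a -> 0 < e ->
  exists (F : X -> Y) (d : R), [/\ 0 < d, lip_mod setT (G a) (C * e) F,
    forall x, A x -> ball a d x -> F x = f x &
    forall x, A x -> ball a d x -> `|G x - G a| <= e].
Proof.
move=> [cG sG] Aa e0; have [d d0 hd] := sG a Aa e e0.
have [d' d'0 hd'] := (within_continuous_ballP A G).1 cG a Aa e e0.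
pose B := ball a (Num.min d d') `&` A.
have fB : lip_mod B (G a) e f.
  by move=> y z [/ball_minl yd Ay] [/ball_minl zd Az]; exact: hd.
have := lip_modB fB (@lip_mod_clinear _ _ _ B (G a)).
rewrite subrr addr0 => /lip_mod0P fGB.
have [u uL uB] := hLE.2 B e (f - G a) (ltW e0) fGB.
exists (u + G a), (Num.min d d'); split.
- by rewrite lt_min d0.
- have := lip_modD ((lip_mod0P _ _ _).2 uL) (@lip_mod_clinear _ _ _ setT (G a)).
  by rewrite add0r addr0.
- move=> x Ax xd; change (u x + G a x = f x); rewrite uB; last by split.
  by change (f x - G a x + G a x = f x); rewrite subrK.
- by move=> x Ax /ball_minr; rewrite distrC; exact: hd'.
Qed.

(** Gluing the local extensions.  They agree on $A$, so that they differ little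
    from each other near $A$, where the (locally Lipschitz) weights therefore
    contribute little. *)
Lemma near_extension (e : R) : condition_W A f G -> 0 < e ->
  exists (F : X -> Y) (rho : X -> R), forall a, A a ->
  [/\ 0 < rho a, lip_mod (ball a (rho a)) (G a) ((C + 2) * e) F & F a = f a].
Proof.
move=> hW e0.
have /choice[Fd hFd] : forall a, exists Fd : (X -> Y) * R, A a -> [/\ 0 < Fd.2,
    lip_mod setT (G a) (C * e) Fd.1,
    forall x, A x -> ball a Fd.2 x -> Fd.1 x = f x &
    forall x, A x -> ball a Fd.2 x -> `|G x - G a| <= e].
  move=> a; have [Aa|nA] := pselect (A a); last by exists (f, 1).
  by have [F [d ?]] := local_extension hW Aa e0; exists (F, d).
have [psi [M [psi0 _ M0 hglue]]] := C1_partition A (fun a => (Fd a).2) C0 hLA.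
have [F hF] := hglue Y (fun _ i => (Fd i).1).
pose K := C * e + L.
have K0 : 0 <= K by rewrite addr_ge0// mulr_ge0// ltW.
suff /choice[rho hrho] : forall a, exists rho : R, A a ->
    [/\ 0 < rho, lip_mod (ball a rho) (G a) ((C + 2) * e) F & F a = f a].
  by exists F, rho.
move=> a; have [Aa|nA] := pselect (A a); last by exists 1.
have [|d [N [Q [i [d0 hQ psi1 FE]]]]] := hF a.
  by exists a => //; apply: ballxx; have [] := hFd a Aa.
have ai n : (n < N)%N -> Q n -> A (i n) /\ ball (i n) (Fd (i n)).2 a.
  by move=> nN /(hQ n nN)[Ai /(_ a (ballxx a d0))].
have Fia n : (n < N)%N -> Q n -> (Fd (i n)).1 a = f a.
  move=> nN Qn; have [Ai ia] := ai n nN Qn.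
  by have [_ _ h _] := hFd _ Ai; exact: h.
have FiL n : (n < N)%N -> Q n -> lip_mod setT 0 K (Fd (i n)).1.
  move=> nN Qn; have [Ai ia] := ai n nN Qn; have [_ h _ _] := hFd _ Ai.
  apply: lip_mod_le (lip_mod_change 0 h).
  by rewrite subr0 lerD2l; exact: hG.
(* all the pieces take the value f a at a and are K-Lipschitz, hence on a ball
   of radius e / (s + 1) around a they are close enough to f a *)
pose s := \sum_(n < N | Q n) M n * K.
have s0 : 0 <= s by apply: sumr_ge0 => n _; rewrite mulr_ge0.
have s1 : 0 < s + 1 by lra.
exists (Num.min d (e / (s + 1))) => _; split.
- by rewrite lt_min d0 divr_gt0.
- have -> : (C + 2) * e = (C * e + e) + e by ring.
  apply: (@glue_lip_mod _ _ _ _ _ N Q psi (fun n => (Fd (i n)).1) M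
    (fun _ => K * (e / (s + 1))) _ _ (cst (f a))) => //.
  + by move=> x /ball_minl; exact: psi1.
  + move=> n nN Qn; have [_ _] := hQ n nN Qn.
    by apply: lip_modS; exact: ball_minl.
  + move=> n nN Qn; have [Ai ia] := ai n nN Qn; have [_ h _ hGi] := hFd _ Ai.
    apply: lip_modS (@subsetT _ _) _.
    apply: lip_mod_le (lip_mod_change (G a) h).
    by rewrite lerD2l distrC; exact: hGi.
  + move=> n x nN Qn /ball_minr; rewrite in_ballE => xa.
    rewrite -(Fia n nN Qn) (le_trans (lip_mod0_norm (FiL n nN Qn) _ _))//.
    by rewrite ler_wpM2l// distrC ltW.
  + under eq_bigr do rewrite mulrA.
    rewrite -mulr_suml -/s mulrA ler_pdivrMr//; nra.
  + by move=> x /ball_minl; exact: FE.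
- rewrite FE; last exact: ballxx.
  rewrite -[RHS]scale1r -(psi1 a (ballxx a d0)) scaler_suml.
  by apply: eq_bigr => n Qn; rewrite Fia.
Qed.

(** An extension that is well behaved near each point of $A$ is Lipschitz on a
    smaller neighbourhood of $A$, hence coincides there with a Lipschitz map
    on the whole space. *)
Lemma lipschitz_near_extension (e : R) : condition_W A f G -> 0 < e ->
  exists (F : X -> Y) (r : X -> R),
  lip_mod setT 0 (C * (2 * (L + (C + 2) * e))) F /\ forall a, A a ->
  [/\ 0 < r a, lip_mod (ball a (r a)) (G a) ((C + 2) * e) F & F a = f a].
Proof.
move=> hW e0; have [F [rho hrho]] := near_extension hW e0.
have Ce0 : 0 <= (C + 2) * e by rewrite mulr_ge0 ?addr_ge0// ltW.
pose K := L + (C + 2) * e.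
have K0 : 0 <= K by rewrite addr_ge0.
pose W := [set x | exists2 a, A a & ball a (rho a / 5) x].
have FK a : A a -> lip_mod (ball a (rho a)) 0 K F.
  move=> Aa; have [_ h _] := hrho a Aa; apply: lip_mod_le (lip_mod_change 0 h).
  by rewrite subr0 addrC lerD2r; exact: hG.
have F2 : lip_mod W 0 (2 * K) F.
  suff key y z a b : A a -> ball a (rho a / 5) y -> A b ->
      ball b (rho b / 5) z -> rho b <= rho a ->
      `|F z - F y| <= 2 * K * `|z - y|.
    move=> y z [a Aa ay] [b Ab bz]; rewrite subr0.
    have [ba|/ltW ab] := leP (rho b) (rho a); first exact: key ay Ab bz ba.
    by rewrite distrC [`|z - y|]distrC; exact: key bz Aa ay ab.
  move=> Aa ay Ab bz ba.
  have [ra ha Fa] := hrho a Aa; have [rb hb Fb] := hrho b Ab.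
  have ay' : ball a (rho a) y by apply: le_ball ay; lra.
  have bz' : ball b (rho b) z by apply: le_ball bz; lra.
  (* if z is not in the large ball around a, then |z - y| is at least 4/5 of
     rho a, and passing through a and b costs at most a factor 2 *)
  have [az|az] := pselect (ball a (rho a) z).
    rewrite (le_trans (lip_mod0_norm (FK a Aa) ay' az))//.
    by rewrite ler_wpM2r//; lra.
  have h1 := lip_mod0_norm (FK a Aa) (ballxx a ra) ay'.
  have h2 := lip_mod0_norm (FK b Ab) (ballxx b rb) bz'.
  have h3 := lip_mod0_norm hf Aa Ab.
  have {}az : rho a <= `|a - z|.
    by rewrite leNgt; apply/negP => az'; apply: az; rewrite in_ballE.
  move: ay bz; rewrite !in_ballE => ay bz.
  rewrite Fa in h1; rewrite Fb in h2.
  have t1 : `|a - z| <= `|z - y| + `|a - y|.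
    have -> : a - z = (a - y) - (z - y) by zmod.
    by rewrite [leRHS]addrC ler_normB.
  have t2 : `|b - a| <= `|b - z| + `|z - y| + `|a - y|.
    have -> : b - a = (b - z) + (z - y) - (a - y) by zmod.
    by rewrite (le_trans (ler_normB _ _))// lerD2r ler_normD.
  have t3 : `|F z - F y| <= `|F z - f b| + `|f b - f a| + `|F y - f a|.
    have -> : F z - F y = (F z - f b) + (f b - f a) - (F y - f a) by zmod.
    by rewrite (le_trans (ler_normB _ _))// lerD2r ler_normD.
  rewrite [`|y - a|]distrC in h1; rewrite [`|z - b|]distrC in h2.
  have LK : L <= K by rewrite lerDl.
  have b1 : L * `|b - a| <= K * (`|b - z| + `|z - y| + `|a - y|).
    by rewrite ler_pM.
  rewrite (le_trans t3)//.
  apply: (@le_trans _ _ (K * (2 * `|b - z| + `|z - y| + 2 * `|a - y|))).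
    by lra.
  rewrite [2 * K]mulrC -mulrA ler_wpM2l//; lra.
have [Fh FhL FhW] := hLE.2 W (2 * K) F (mulr_ge0 (ler0n _ 2) K0)
  ((lip_mod0P _ _ _).1 F2).
exists Fh, (fun a => rho a / 5); split; first exact/lip_mod0P.
move=> a Aa; have [ra ha Fa] := hrho a Aa; have r5 : 0 < rho a / 5 by lra.
split=> //; last by rewrite FhW ?Fa//; exists a => //; exact: ballxx.
apply: (@eq_lip_mod _ _ _ _ _ _ F).
  by move=> x ax; rewrite FhW//; exists a.
by apply: lip_modS ha; apply: le_ball; lra.
Qed.

End NearExtension.

(** * Smoothing *)

Lemma closed_avoid (R : realType) (X : normedModType R) (F : set X) x :
  closed F -> ~ F x -> exists2 d : R, 0 < d & forall y, ball x d y -> ~ F y.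
Proof.
move=> cF Fx; have [d d0 dF] := open_ball (closed_openC cF) Fx.
by exists d.
Qed.

Lemma sum_half_le (R : realType) N (Q : pred nat) :
  \sum_(n < N | Q n) (2^-1 : R) ^+ n.+1 <= 1.
Proof.
rewrite big_mkcond /=.
apply: (@le_trans _ _ (\sum_(n < N) (2^-1 : R) ^+ n.+1)).
  by apply: ler_sum => n _; case: ifP => // _; rewrite exprn_ge0.
suff -> : \sum_(n < N) (2^-1 : R) ^+ n.+1 = 1 - 2^-1 ^+ N.
  by rewrite gerBl exprn_ge0.
elim: N => [|N IH]; first by rewrite big_ord0 expr0 subrr.
by rewrite big_ord_recr /= IH !exprS; field.
Qed.

Section Smoothing.
Context {R : realType} {X Y : normedModType R} (C : R).
Hypotheses (C1 : 1 <= C) (hLA : LA_on_balls X Y C) (hLR : LA_on_balls X R C).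
Variables (Omega A : set X).
Hypotheses (oOmega : open Omega)
  (hA : exists2 F : set X, closed F & A = Omega `&` F).
Variables (F : X -> Y) (G : X -> clinear X Y) (r : X -> R) (K L l eta : R).
Hypotheses (K0 : 0 <= K) (l0 : 0 <= l) (L0 : 0 <= L) (eta0 : 0 < eta).
Hypotheses (FK : lip_mod setT 0 K F) (hG : forall a, A a -> `|G a| <= L).
Hypotheses (Fr : forall a, A a ->
  [/\ 0 < r a, ball a (r a) `<=` Omega & lip_mod (ball a (r a)) (G a) l F]).

(** The pieces whose domains meet this region around $A$ will be close to a
    value of $G$. *)
Let N := [set y | exists2 a, A a & ball a (r a / 2) y].

(** On the ball of radius $d$ around $i$ the map $F-T$ is $k$-Lipschitz, with a
    small $k$ if possible.  Otherwise $T=0$ and $k=K$, and then the ball must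
    avoid the region $N$.  A ball that meets $A$ has its centre in $A$, and
    twice this ball is still inside $N$. *)
Let good_ball (p : R * clinear X Y * R) (i : X) :=
  let: (d, T, k) := (p.1.1, p.1.2, p.2) in
  [/\ 0 < d, ball i (2 * d) `<=` Omega, lip_mod (ball i d) T k F,
   (`|T| <= L /\ k = l) \/
     [/\ T = 0, k = K & forall y, ball i d y -> ~ N y] &
   forall y, A y -> ball i d y -> A i /\ 2 * d <= r i / 2].

Lemma local_data i : Omega i -> exists p, good_ball p i.
Proof.
move=> Oi; have [dO dO0 hO] := open_ball oOmega Oi.
have [Ai|nAi] := pselect (A i).
  have [ri0 rO hr] := Fr Ai; exists (r i / 4, G i, l); split=> /=.
  - by lra.
  - by apply: subset_trans rO; apply: le_ball; lra.
  - by apply: lip_modS hr; apply: le_ball; lra.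
  - by left; split=> //; exact: hG.
  - by move=> *; split=> //; lra.
have [B cB AE] := hA.
have [|dA dA0 hdA] := closed_avoid (x := i) cB.
  by move=> Bi; apply: nAi; rewrite AE.
pose d := Num.min dO dA / 2.
have d0 : 0 < d by rewrite divr_gt0// lt_min dO0.
have dE : 2 * d = Num.min dO dA by rewrite /d mulrC divfK.
have iO : ball i (2 * d) `<=` Omega.
  by rewrite dE; apply: subset_trans hO; exact: ball_minl.
have iA y : ball i (2 * d) y -> ~ A y.
  by rewrite dE => /ball_minr/hdA By; rewrite AE => -[].
have sub e : e <= d -> ball i e `<=` ball i (2 * d).
  by move=> ed; apply: le_ball; lra.
have [[a Aa ai]|far] := pselect (exists2 a, A a & ball a (r a) i).
  have [ra0 rO hr] := Fr Aa; have [e e0 he] := open_ball (ball_open a (r a)) ai.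
  exists (Num.min d e, G a, l); split=> /=.
  - by rewrite lt_min d0.
  - apply: subset_trans iO; apply: le_ball.
    have : Num.min d e <= d by rewrite ge_min lexx.
    lra.
  - by apply: lip_modS hr; apply: subset_trans he; exact: ball_minr.
  - by left; split=> //; exact: hG.
  - move=> y Ay iy; exfalso; apply: (iA y) => //; apply: sub iy.
    by rewrite ge_min lexx.
exists (d, 0, K); split=> //=.
- exact: lip_modS (@subsetT _ _) FK.
(* a point common to this ball and to N would bring i into the ball of radius
   r a around a *)
- right; split=> // y iy [a Aa ay]; apply: far; exists a => //.
  have ria : 2 * d <= `|i - a|.
    rewrite leNgt; apply/negP => ia; apply: (iA a) => //.
    by rewrite in_ballE.
  move: iy ay; rewrite !in_ballE => iy ay.
  have : `|i - a| <= `|i - y| + `|a - y|.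
    have -> : i - a = (i - y) - (a - y) by zmod.
    exact: ler_normB.
  by rewrite (distrC a i); lra.
- by move=> y Ay iy; exfalso; apply: (iA y) => //; exact: sub iy.
Qed.

(** Glue smooth approximations of $F$ on the balls of the previous lemma.  The
    error made on the ball of $i$ is at most $\eta d_i$, hence at each point at
    most $\eta$ times its distance to any point outside the double of every
    ball that contains it.  This makes local Lipschitz bounds global: either the
    segment between two points stays where the local bound holds, or both
    points are far enough from some point for the error to be harmless. *)
Lemma smoothing : exists g : X -> Y,
  [/\ C1s Omega g, lip_mod Omega 0 (C * K + L + C * l + 2 * eta) g,
   forall a, A a -> lip_mod (ball a (r a / 2)) 0 (l + C * l + eta) (F - g) &
   lip_mod A 0 (l + C * l + 2 * eta) (F - g)].
Proof.
have C0 : 0 <= C by exact: le_trans ler01 C1.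
have eta_gt0 := eta0; have [l_ge0 L_ge0] := (l0, L0).
have /choice[p hp] : forall i, exists p, Omega i -> good_ball p i.
  move=> i; have [Oi|nO] := pselect (Omega i); last by exists (0, 0, 0).
  by have [p ?] := local_data Oi; exists p.
pose d i := (p i).1.1; pose T i := (p i).1.2; pose k i := (p i).2.
have d0 i : Omega i -> 0 < d i by move=> /hp[].
have k0 i : Omega i -> 0 <= k i.
  by move=> /hp[_ _ _ + _]; rewrite /k => -[[_ ->]|[_ -> _]].
have [psi [M [psi0 psiC M0 hglue]]] := C1_partition Omega d C0 hLR.
(* the second bound makes the sum of the products M n * m n i at most eta *)
pose m n i := Num.min (eta * d i) (eta * 2^-1 ^+ n.+1 / (M n + 1)).
have M1 n : 0 < M n + 1 by rewrite ltr_wpDl.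
have m0 n i : Omega i -> 0 < m n i.
  by move=> /d0 di; rewrite lt_min !(divr_gt0, mulr_gt0, exprn_gt0).
have /choice[h hh] : forall ni : nat * X, exists h, Omega ni.2 ->
    [/\ lip_mod (ball ni.2 (d ni.2)) (T ni.2) (C * k ni.2) h,
        C1s (ball ni.2 (d ni.2)) h &
        forall x, ball ni.2 (d ni.2) x -> `|F x - h x| <= m ni.1 ni.2].
  move=> [n i] /=; have [Oi|nO] := pselect (Omega i); last by exists F.
  have [_ _ FT _ _] := hp i Oi.
  have [h ?] := LA_on_balls_mod hLA (d0 i Oi) (k0 i Oi) (m0 n i Oi) FT.
  by exists h.
have [g hg] := hglue Y (fun n i => h (n, i)).
have gO y : Omega y -> locally_glued Omega d psi M (fun n i => h (n, i)) g y.
  by move=> Oy; apply: hg; exists y => //; exact/ballxx/d0.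
have sumM NN (Q : pred nat) (i : nat -> X) :
    \sum_(n < NN | Q n) M n * m n (i n) <= eta.
  rewrite -[leRHS]mulr1.
  rewrite (le_trans _ (ler_wpM2l (ltW eta0) (sum_half_le R NN Q)))//.
  rewrite mulr_sumr; apply: ler_sum => n _.
  apply: (@le_trans _ _ (M n * (eta * 2^-1 ^+ n.+1 / (M n + 1)))).
    by rewrite ler_wpM2l// ge_min lexx orbT.
  rewrite mulrA ler_pdivrMr// mulrC.
  rewrite ler_wpM2l ?mulr_ge0 ?exprn_ge0 ?(ltW eta0)//.
  by rewrite lerDl.
have gC : C1s Omega g.
  move=> y Oy; have [e [NN [Q [i [e0 hQ _ gE]]]]] := gO y Oy.
  have [|S hS] := @C1s_sum _ _ _ (ball y e) Q
      (fun n x => psi n x *: h (n, i n) x) NN _ y (ballxx y e0).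
    move=> n nN Qn x yx; have [Oi iy _] := hQ n nN Qn.
    have [_ hC _] := hh (n, i n) Oi.
    have [S1 hS1] := psiC n x I; have [S2 hS2] := hC x (iy x yx).
    by eexists; exact: (strict_diffZ hS1 hS2).
  by exists S; apply: (strict_diff_eq e0 _ hS) => x /gE ->.
have err x e : Omega x ->
    (forall i, Omega i -> ball i (d i) x -> eta * d i <= e) ->
    `|F x - g x| <= e.
  move=> Ox hx; have [s [NN [Q [i [s0 hQ psi1 gE]]]]] := gO x Ox.
  rewrite gE; last exact: ballxx.
  apply: (@glue_dist _ _ NN Q (fun n => psi n x)
    (fun n => h (n, i n) x)) => //; first by apply: psi1; exact: ballxx.
  move=> n nN Qn; have [Oi ix _] := hQ n nN Qn.
  have xi := ix x (ballxx x s0); have [_ _ hm] := hh (n, i n) Oi.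
  rewrite (le_trans (hm x xi))// (le_trans _ (hx _ Oi xi))//.
  by rewrite ge_min lexx.
(* the pieces are (C * K)-Lipschitz or (L + C * l)-Lipschitz *)
pose K1 := C * K + L + C * l.
have loc y : Omega y -> exists2 e : R, 0 < e &
    lip_mod (ball y e) 0 (K1 + eta) g.
  move=> Oy; have [e [NN [Q [i [e0 hQ psi1 gE]]]]] := gO y Oy.
  exists e => //; apply: (@glue_lip_mod _ _ _ _ _ NN Q psi
    (fun n x => h (n, i n) x) M (fun n => m n (i n)) _ _ F) => //.
  - by move=> n nN Qn; have [] := hQ n nN Qn.
  - move=> n nN Qn; have [Oi iy _] := hQ n nN Qn.
    have [hL _ _] := hh (n, i n) Oi.
    apply: lip_modS iy _; apply: lip_mod_le (lip_mod_change 0 hL).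
    rewrite subr0 /K1 /= /k /T; have [_ _ _ + _] := hp _ Oi.
    have Cl : 0 <= C * l by rewrite mulr_ge0.
    have CK : 0 <= C * K by rewrite mulr_ge0.
    have b1 : C * K <= C * K + L + C * l by rewrite -addrA lerDl addr_ge0.
    have b2 : C * l + L <= C * K + L + C * l by rewrite addrC lerD2r lerDr.
    case=> [[TL ->]|[-> -> _]]; last by rewrite normr0 addr0.
    by apply: le_trans (lerD (lexx _) TL) b2.
  - move=> n x nN Qn yx; have [Oi iy _] := hQ n nN Qn.
    by have [_ _ hm] := hh (n, i n) Oi; rewrite distrC; apply: hm; exact: iy.
have locN y : N y -> exists2 e : R, 0 < e &
    lip_mod (ball y e) 0 (l + C * l + eta) (F - g).
  move=> Ny; have Oy : Omega y.
    have [a Aa ay] := Ny; have [ra0 rO _] := Fr Aa; apply: rO.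
    by apply: le_ball ay; lra.
  have [e [NN [Q [i [e0 hQ psi1 gE]]]]] := gO y Oy.
  exists e => //; apply: (@glue_lip_mod _ _ _ _ _ NN Q psi
    (fun n => F - h (n, i n)) M (fun n => m n (i n)) _ _ (cst 0)) => //.
  - by move=> n nN Qn; have [] := hQ n nN Qn.
  - move=> n nN Qn; have [Oi iy _] := hQ n nN Qn.
    have [hL _ _] := hh (n, i n) Oi.
    have [_ _ FT kT _] := hp _ Oi.
    have := lip_modB FT hL; rewrite subrr => FhL.
    have kl : k (i n) = l.
      case: kT => [[] //|[_ _ nN']].
      by have := nN' _ (iy y (ballxx y e0)) Ny.
    by move: FhL; rewrite /= -/(k (i n)) kl; exact: lip_modS.
  - move=> n x nN Qn yx; have [Oi iy _] := hQ n nN Qn.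
    have [_ _ hm] := hh (n, i n) Oi; rewrite subr0.
    exact: (hm x (iy x yx)).
  - move=> x yx; change (F x - g x =
      \sum_(n < NN | Q n) psi n x *: (F x - h (n : nat, i n) x)).
    rewrite gE// -[F x in LHS]scale1r -(psi1 x yx) scaler_suml -sumrB.
    by apply: eq_bigr => n _; rewrite scalerBr.
have nearA a : A a -> lip_mod (ball a (r a / 2)) 0 (l + C * l + eta) (F - g).
  move=> Aa; apply: local_lip_mod_ball => q aq.
  have [|e e0 he] := locN q; first by exists a.
  exists e => // w wq; apply: he; first exact: ballxx.
  by rewrite in_ballE distrC.
exists g; split=> //.
- move=> y z Oy Oz; rewrite subr0.
  have [seg|/existsNP[t /not_implyP[t01 nO]]] := pselect (forall t,
      0 <= t <= 1 -> Omega (y + t *: (z - y))).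
    have := @local_lip_mod_segment _ _ _ 0 (K1 + eta) g y z; rewrite subr0.
    move=> h1; have {}h1 : `|g z - g y| <= (K1 + eta) * `|z - y|.
      apply: h1 => t /seg/loc[e e0 he]; exists e => // w wq.
      by apply: he; [exact: ballxx|rewrite in_ballE distrC].
    by rewrite (le_trans h1)// ler_wpM2r// /K1; lra.
  set q := y + t *: (z - y) in nO.
  have away x : Omega x -> `|F x - g x| <= eta * `|x - q|.
    move=> Ox; apply: err => // i Oi; rewrite in_ballE => ix.
    rewrite ler_wpM2l ?(ltW eta0)//.
    have : 2 * d i <= `|i - q|.
      rewrite leNgt; apply/negP => iq; apply: nO.
      by have [_ iO _ _ _] := hp i Oi; apply: iO; rewrite in_ballE.
    have : `|i - q| <= `|i - x| + `|x - q|.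
      have -> : i - q = (i - x) + (x - q) by zmod.
      exact: ler_normD.
    lra.
  have hy := away y Oy; have hz := away z Oz.
  have hF := lip_mod0_norm FK (I : setT y) (I : setT z).
  have hs := segment_dist y z t01; rewrite -/q (distrC q) in hs.
  have : `|g z - g y| <= `|F z - F y| + `|F z - g z| + `|F y - g y|.
    have -> : g z - g y = (F z - F y) - (F z - g z) + (F y - g y) by zmod.
    by rewrite (le_trans (ler_normD _ _))// lerD2r ler_normB.
  have CK : K * `|z - y| <= C * K * `|z - y|.
    by rewrite -mulrA ler_peMl// mulr_ge0.
  have Ll : 0 <= (L + C * l) * `|z - y| by rewrite mulr_ge0 ?addr_ge0 ?mulr_ge0.
  have e0 : 0 <= eta * `|z - y| by rewrite mulr_ge0 ?(ltW eta0).
  have hs' : eta * `|y - q| + eta * `|z - q| = eta * `|z - y|.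
    by rewrite -mulrDr hs.
  lra.
- move=> a b Aa Ab; rewrite subr0.
  have AO x : A x -> Omega x by have [B _ ->] := hA; case.
  have half x y : A x -> A y ->
      (exists i, [/\ Omega i, ball i (d i) x & ball i (2 * d i) y]) ->
      `|(F - g) y - (F - g) x| <= (l + C * l + 2 * eta) * `|y - x|.
    move=> Ax Ay [i [Oi ix iy]]; have [di _ _ _ hi] := hp i Oi.
    have [Ai di2] := hi x Ax ix.
    have di1 : d i <= r i / 2.
      by apply: le_trans di2; rewrite ler_peMl ?ler1n// ltW.
    have h1 := lip_mod0_norm (nearA i Ai) (le_ball di1 ix) (le_ball di2 iy).
    by rewrite (le_trans h1)// ler_wpM2r//; lra.
  have far x y : A x -> A y ->
      ~ (exists i, [/\ Omega i, ball i (d i) x & ball i (2 * d i) y]) ->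
      `|F x - g x| <= eta * `|y - x|.
    move=> Ax Ay no; apply: err; first exact: AO.
    move=> i Oi ix; rewrite ler_wpM2l ?(ltW eta0)//.
    have : 2 * d i <= `|i - y|.
      rewrite leNgt; apply/negP => iy; apply: no; exists i; split=> //.
      by rewrite in_ballE.
    have : `|i - y| <= `|i - x| + `|y - x|.
      have -> : i - y = (i - x) - (y - x) by zmod.
      exact: ler_normB.
    by move: ix; rewrite in_ballE; lra.
  have [ab|/(far a b Aa Ab) ha] := pselect (exists i,
      [/\ Omega i, ball i (d i) a & ball i (2 * d i) b]).
    exact: half.
  have [ba|/(far b a Ab Aa) hb] := pselect (exists i,
      [/\ Omega i, ball i (d i) b & ball i (2 * d i) a]).
    by rewrite distrC [`|b - a|]distrC; exact: half.
  change (`|F b - g b - (F a - g a)| <= (l + C * l + 2 * eta) * `|b - a|).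
  rewrite (le_trans (ler_normB _ _))//.
  have : 0 <= (l + C * l) * `|b - a| by rewrite mulr_ge0 ?addr_ge0 ?mulr_ge0.
  by rewrite [`|a - b|]distrC in hb; lra.
Qed.

End Smoothing.

(** * Limits of geometrically controlled sequences *)

Section GeometricLimit.
Context {R : realType}.
Local Notation half n := ((2^-1 : R) ^+ n).

Lemma le_half_pow0 (x K : R) : (forall n, x <= K * half n) -> x <= 0.
Proof.
move=> h; rewrite leNgt; apply/negP => x0.
have K0 : 0 < K by have := h 0%N; rewrite expr0 mulr1; exact: lt_le_trans.
have [n] := scale_of_small (divr_gt0 x0 K0).
by rewrite ltr_pdivlMr// mulrC ltNge h.
Qed.

Lemma geometric_limit (V : completeNormedModType R) (u : nat -> V) (D : R) :
  (forall n, `|u n.+1 - u n| <= D * half n) ->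
  exists l, forall n, `|l - u n| <= 2 * D * half n.
Proof.
move=> h.
have D0 : 0 <= D by have := h 0%N; rewrite expr0 mulr1; exact: le_trans.
have dist n k : `|u (n + k)%N - u n| <= 2 * D * half n * (1 - half k).
  elim: k => [|k IH]; first by rewrite addn0 !subrr normr0 mulr0.
  have -> : u (n + k.+1)%N - u n =
    (u (n + k).+1 - u (n + k)%N) + (u (n + k)%N - u n) by rewrite addnS; zmod.
  rewrite (le_trans (ler_normD _ _))// (le_trans (lerD (h _) IH))//.
  by rewrite exprD exprS le_eqVlt; apply/orP; left; apply/eqP; field.
have dist' n m : (n <= m)%N -> `|u m - u n| <= 2 * D * half n.
  move=> /subnKC <-; apply: (le_trans (dist n _)).
  by rewrite ler_piMr ?mulr_ge0 ?exprn_ge0// gerBl exprn_ge0.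
have cu : cvgn u.
  apply/cauchy_cvgP/cauchy_exP => e e0.
  have e2 : 0 < e / (2 * D + 1) by rewrite divr_gt0// ltr_wpDl ?mulr_ge0.
  have [n ne] := scale_of_small e2; exists (u n); exists n => // m /= nm.
  rewrite in_ballE distrC (le_lt_trans (dist' _ _ nm))//.
  move: ne; rewrite ltr_pdivlMr ?ltr_wpDl ?mulr_ge0// /scale_of.
  have : 0 < half n by rewrite exprn_gt0.
  nra.
exists (limn u) => n.
have cn : `|u m - u n| @[m --> \oo] --> `|limn u - u n|.
  by apply: cvg_norm; apply: cvgB; [exact: cu|exact: cvg_cst].
rewrite -(cvg_lim _ cn)//; apply: limr_le.
  by apply/cvg_ex; exists `|limn u - u n|.
by exists n => // m /=; exact: dist'.
Qed.

Lemma clinear_geometric_limit (X : normedModType R)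
    (Y : completeNormedModType R) (T : nat -> clinear X Y) (D : R) :
  (forall n, `|T n.+1 - T n| <= D * half n) ->
  exists S : clinear X Y, forall n, `|S - T n| <= 2 * D * half n.
Proof.
move=> h.
have D0 : 0 <= D by have := h 0%N; rewrite expr0 mulr1; exact: le_trans.
have /choice[f hf] : forall v, exists l,
    forall n, `|l - T n v| <= 2 * (D * `|v|) * half n.
  move=> v; apply: (@geometric_limit Y) => n.
  by rewrite mulrAC (le_trans (clinear_norm (T n.+1 - T n) v))// ler_wpM2r.
have lf : linear f.
  move=> a u v; apply/eqP; rewrite -subr_eq0 -normr_le0.
  pose K := 2 * (D * `|a *: u + v|) + `|a| * (2 * (D * `|u|)) + 2 * (D * `|v|).
  apply: (@le_half_pow0 _ K) => n.
  have -> : f (a *: u + v) - (a *: f u + f v) =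
     (f (a *: u + v) - T n (a *: u + v)) - (a *: (f u - T n u)) - (f v - T n v).
    by rewrite clinearD clinearZ scalerBr; zmod.
  rewrite /K [leRHS]mulrDl [X in _ <= X + _]mulrDl.
  rewrite (le_trans (ler_normB _ _))// lerD//.
  rewrite (le_trans (ler_normB _ _))// lerD// normrZ -mulrA ler_wpM2l//.
have fK v : `|f v| <= (`|T 0%N| + 2 * D) * `|v|.
  have -> : f v = T 0%N v + (f v - T 0%N v) by zmod.
  rewrite (le_trans (ler_normD _ _))// mulrDl lerD ?clinear_norm//.
  by rewrite (le_trans (hf v 0%N))// expr0 mulr1 mulrA.
exists (CLinear (bounded_is_clinear lf fK)) => n.
apply: clinear_norm_le; first by rewrite !mulr_ge0 ?exprn_ge0.
move=> v; have -> : 2 * D * half n * `|v| = 2 * (D * `|v|) * half n by ring.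
exact: hf.
Qed.

End GeometricLimit.

(** * Approximation and extension *)

Section OneStep.
Context {R : realType} {X Y : normedModType R} (C : R).
Hypotheses (C1 : 1 <= C) (hLE : property_LE X Y C).
Hypotheses (hLA : LA_on_balls X Y C) (hLR : LA_on_balls X R C).
Variables (Omega A : set X).
Hypotheses (oOmega : open Omega)
  (hA : exists2 F : set X, closed F & A = Omega `&` F).
Implicit Types (f g : X -> Y) (G : X -> clinear X Y).

Lemma sub_Omega : A `<=` Omega.
Proof. by have [B _ ->] := hA; move=> x []. Qed.

Lemma condition_WB f g G : condition_W A f G -> C1s Omega g ->
  condition_W A (f - g) (G - frechet g).
Proof.
move=> [cG sG] gC; have [_ cg] := (C1_onP g oOmega).2 gC.
have {}cg := (within_continuous_ballP _ _).1 cg.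
split.
- apply/within_continuous_ballP => a Aa e e0; have e2 : 0 < e / 2 by lra.
  have [d1 d10 h1] := (within_continuous_ballP A G).1 cG a Aa _ e2.
  have [d2 d20 h2] := cg a (sub_Omega Aa) _ e2.
  exists (Num.min d1 d2); first by rewrite lt_min d10.
  move=> x Ax xd; have b1 := h1 x Ax (ball_minl xd).
  have b2 := h2 x (sub_Omega Ax) (ball_minr xd).
  have -> : (G - frechet g) a - (G - frechet g) x =
      (G a - G x) - (frechet g a - frechet g x).
    change (G a - frechet g a - (G x - frechet g x) =
      (G a - G x) - (frechet g a - frechet g x)).
    by zmod.
  by rewrite (le_trans (ler_normB _ _))// [e]splitr lerD.
- move=> a Aa e e0; have e2 : 0 < e / 2 by lra.
  have [d1 d10 h1] := sG a Aa _ e2.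
  have [d2 d20 h2] := strict_diff_frechet gC (sub_Omega Aa) e2.
  exists (Num.min d1 d2); first by rewrite lt_min d10.
  pose U := ball a (Num.min d1 d2) `&` A.
  have U1 : lip_mod U (G a) (e / 2) f.
    by move=> y z [/ball_minl yd Ay] [/ball_minl zd Az]; exact: h1.
  have U2 : lip_mod U (frechet g a) (e / 2) g.
    by apply: lip_modS h2 => y [/ball_minr].
  by have := lip_modB U1 U2; rewrite -splitr; exact.
Qed.

(** One step of the iteration: an approximate extension whose error on $A$ has
    half the Lipschitz constant of $f$ and half the bound on the derivative. *)
Lemma C1_approximation f G (L : R) (a0 : X) : 0 < L -> A a0 ->
  lip_mod A 0 L f -> condition_W A f G -> (forall a, A a -> `|G a| <= L) ->
  exists g, [/\ C1s Omega g, lip_mod Omega 0 (4 * C ^+ 2 * L) g, g a0 = f a0,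
    lip_mod A 0 (L / 2) (f - g) &
    forall a, A a -> `|G a - frechet g a| <= L / 2].
Proof.
move=> L0 Aa0 hf hW hG; have C_ge1 := C1.
have C0 : 0 <= C by exact: le_trans ler01 C1.
have Cpos : 0 < C by exact: lt_le_trans ltr01 C1.
(* with l the constant of F - G a near a, both l and C * l are at most 3/20 L,
   and C * (C * l) at most 3/20 (C L) *)
pose e := L / (20 * C ^+ 2).
have e0 : 0 < e by rewrite divr_gt0 ?mulr_gt0 ?exprn_gt0.
have eE : C ^+ 2 * e = L / 20 by rewrite /e; field; rewrite gt_eqF.
pose l := (C + 2) * e.
have [F [r [FL hr]]] :=
  lipschitz_near_extension C0 hLE hLR (ltW L0) hf hG hW e0.
have l0 : 0 <= l by rewrite mulr_ge0 ?addr_ge0// ltW.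
have /choice[s hs] : forall a, exists s : R, A a -> [/\ 0 < s,
   ball a s `<=` Omega & lip_mod (ball a s) (G a) l F].
  move=> a; have [Aa|nA] := pselect (A a); last by exists 0.
  have [d d0 dO] := open_ball oOmega (sub_Omega Aa); have [ra ha _] := hr a Aa.
  exists (Num.min d (r a)) => _; split; first by rewrite lt_min d0.
    by apply: subset_trans dO; exact: ball_minl.
  by apply: lip_modS ha; exact: ball_minr.
have K0 : 0 <= C * (2 * (L + l)) by rewrite !mulr_ge0// addr_ge0// ltW.
have [g0 [gC gL gN gA]] :=
  smoothing C1 hLA hLR oOmega hA K0 l0 (ltW L0) e0 FL hG hs.
have eC : e <= L / 20 by rewrite -eE ler_peMl ?(ltW e0)// expr_ge1.
have eC2 : C * e <= L / 20.
  by rewrite -eE expr2 -mulrA ler_peMl// mulr_ge0// ltW.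
have lL : l <= 3 * (C * e) by rewrite /l; nra.
have Cl : C * l <= 3 * L / 20.
  have -> : 3 * L / 20 = C * (3 * (C * e)) by rewrite -mulrA -eE; ring.
  by rewrite ler_wpM2l.
have ll : l <= 3 * L / 20 by lra.
(* the value at a0 is corrected so that the errors of the iteration vanish
   there *)
pose g := g0 + cst (f a0 - g0 a0).
have cstL : lip_mod Omega 0 0 (cst (f a0 - g0 a0) : X -> Y).
  exact: lip_mod_cst.
have gdC : C1s Omega g.
  move=> x /gC[T hT]; exists (T + 0); apply: strict_diffD hT _.
  exact: strict_diff_cst.
have shift U T k h : lip_mod U T k (h - g0) -> lip_mod U T k (h - g).
  move=> hU y z Uy Uz; have := hU y z Uy Uz; congr (`|_| <= _).
  change (h z - g0 z - (h y - g0 y) - T (z - y) =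
    h z - (g0 z + (f a0 - g0 a0)) - (h y - (g0 y + (f a0 - g0 a0)))
    - T (z - y)).
  by zmod.
have FA a : A a -> F a = f a by move=> /hr[].
exists g; split=> //.
- have := lip_modD gL cstL.
  rewrite addr0; apply: lip_mod_le; rewrite addr0.
  have L1 : L <= C ^+ 2 * L by rewrite ler_peMl ?(ltW L0)// expr_ge1.
  have : C * (C * l) <= C * (3 * L / 20) by rewrite ler_wpM2l.
  have CL : C * L <= C ^+ 2 * L.
    by rewrite expr2 -mulrA ler_peMl// mulr_ge0// ltW.
  have -> : C * (C * (2 * (L + l))) = 2 * (C ^+ 2 * L) + 2 * (C * (C * l)).
    by ring.
  rewrite -[4 * _ * _]mulrA; lra.
- change (g0 a0 + (f a0 - g0 a0) = f a0); zmod.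
- apply: (@eq_lip_mod _ _ _ _ _ _ (F - g)).
    by move=> a Aa; change (F a - g a = f a - g a); rewrite FA.
  apply: shift; apply: lip_mod_le gA; lra.
- move=> a Aa; have [sa sO ha] := hs a Aa.
  have hD := strict_diff_frechet gdC (sub_Omega Aa).
  have Fg : lip_mod (ball a (s a / 2)) 0 (l + C * l + e) (F - g).
    by apply: shift; exact: gN.
  have ha' : lip_mod (ball a (s a / 2)) (G a) l F.
    by apply: lip_modS ha; apply: le_ball; lra.
  have := lip_modB ha' Fg; rewrite subr0.
  have -> : F - (F - g) = g.
    by apply/funext => x; change (F x - (F x - g x) = g x); zmod.
  move=> gG; apply/ler_addgt0Pr => t t0.
  have [d d0 hd] := hD t t0.
  apply: (le_trans (@lip_mod_dist _ _ _ a (Num.min d (s a / 2)) _ _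
    (l + (l + C * l + e)) t g g _ _ _ _ _)) => //.
  + by rewrite lt_min d0 divr_gt0.
  + by have := mulr_ge0 C0 l0; lra.
  + by apply: lip_modS gG; exact: ball_minr.
  + by apply: lip_modS hd; exact: ball_minl.
  + by rewrite lerD2r; lra.
Qed.

End OneStep.

Section Iteration.
Context {R : realType} {X : normedModType R} {Y : completeNormedModType R}.
Variable C : R.
Hypotheses (C1 : 1 <= C) (hLE : property_LE X Y C).
Hypotheses (hLA : LA_on_balls X Y C) (hLR : LA_on_balls X R C).
Variables (Omega A : set X).
Hypotheses (oOmega : open Omega)
  (hA : exists2 F : set X, closed F & A = Omega `&` F).
Local Notation half n := ((2^-1 : R) ^+ n).

(** Lipschitz estimates pass to the limit of a telescoping series: the sum from
    $n$ on is $2B2^{-n}$-Lipschitz. *)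
Lemma lip_mod_limit (B : R) (g : X -> Y) (u : nat -> X -> Y) (D : X -> R)
    (U : set X) :
  (forall n, lip_mod U 0 (B * half n) (u n.+1 - u n)) ->
  (forall x n, U x -> `|g x - u n x| <= D x * half n) -> 0 <= B ->
  forall n, lip_mod U 0 (2 * B * half n) (g - u n).
Proof.
move=> hu hg B0 n y z Uy Uz; rewrite subr0.
have tail k : `|(u (n + k)%N - u n) z - (u (n + k)%N - u n) y|
    <= 2 * B * half n * (1 - half k) * `|z - y|.
  elim: k => [|k IH]; first by rewrite addn0 !subrr normr0 mulr0 mul0r.
  rewrite addnS; pose v := (u (n + k).+1 - u (n + k)%N).
  have -> : (u (n + k).+1 - u n) z - (u (n + k).+1 - u n) y =
     (v z - v y) + ((u (n + k)%N - u n) z - (u (n + k)%N - u n) y).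
    change (u (n + k).+1 z - u n z - (u (n + k).+1 y - u n y) =
      (u (n + k).+1 z - u (n + k)%N z - (u (n + k).+1 y - u (n + k)%N y))
      + (u (n + k)%N z - u n z - (u (n + k)%N y - u n y))).
    by zmod.
  have := lip_mod0_norm (hu (n + k)%N) Uy Uz; rewrite -/v => hv.
  rewrite (le_trans (ler_normD _ _))// (le_trans (lerD hv IH))//.
  by rewrite exprD exprS le_eqVlt; apply/orP; left; apply/eqP; field.
rewrite -subr_le0; apply: (@le_half_pow0 _ _ ((D z + D y) * half n)) => k.
have hz := hg z (n + k)%N Uz; have hy := hg y (n + k)%N Uy.
rewrite lerBlDl.
have -> : (g - u n) z - (g - u n) y =
   ((u (n + k)%N - u n) z - (u (n + k)%N - u n) y) +
   ((g z - u (n + k)%N z) - (g y - u (n + k)%N y)).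
  change (g z - u n z - (g y - u n y) =
   (u (n + k)%N z - u n z - (u (n + k)%N y - u n y)) +
   ((g z - u (n + k)%N z) - (g y - u (n + k)%N y))).
  by zmod.
rewrite (le_trans (ler_normD _ _))// lerD//.
  have k1 : 1 - half k <= 1 by rewrite gerBl exprn_ge0.
  apply: (le_trans (tail k)); apply: ler_wpM2r => //; apply: ler_piMr => //.
  by rewrite !mulr_ge0// exprn_ge0.
rewrite (le_trans (ler_normB _ _))// (le_trans (lerD hz hy))//.
by rewrite exprD -mulrDl mulrA.
Qed.

(** Approximate $f$, then the error on $A$, and so on; the constants of the
    approximations decrease like $2^{-n}$, and their sum extends $f$. *)
Lemma C1_extension (f : X -> Y) (G : X -> clinear X Y) (L : R) (a0 : X) :
  0 < L -> A a0 -> lip_mod A 0 L f -> condition_W A f G ->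
  (forall a, A a -> `|G a| <= L) ->
  exists g, [/\ forall a, A a -> g a = f a,
    lip_mod Omega 0 (8 * C ^+ 2 * L) g, C1s Omega g &
    forall a, A a -> strict_diff g a (G a)].
Proof.
move=> L0 Aa0 hf hW hG.
have AO := sub_Omega hA.
have L_ n : 0 < L * half n by rewrite mulr_gt0 ?exprn_gt0.
pose inv n (p : (X -> Y) * (X -> clinear X Y)) :=
  [/\ lip_mod A 0 (L * half n) p.1, condition_W A p.1 p.2 &
      forall a, A a -> `|p.2 a| <= L * half n].
have /choice[st hst] : forall np : nat * ((X -> Y) * (X -> clinear X Y)),
    exists g, inv np.1 np.2 -> [/\ C1s Omega g,
      lip_mod Omega 0 (4 * C ^+ 2 * L * half np.1) g, g a0 = np.2.1 a0 &
      inv np.1.+1 (np.2.1 - g, np.2.2 - frechet g)].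
  move=> [n [p q]] /=.
  have [[hp hpq hq]|no] := pselect (inv n (p, q)); last by exists p.
  have [g [gC gL ga gA gG]] :=
    C1_approximation C1 hLE hLA hLR oOmega hA (L_ n) Aa0 hp hpq hq.
  exists g => _; split=> //; first by rewrite -mulrA.
  have hh : L * half n.+1 = L * half n / 2 by rewrite exprS; field.
  by split=> /=; rewrite ?hh//; exact: (condition_WB oOmega hA hpq gC).
pose fix data n := if n is m.+1 then
  ((data m).1 - st (m, data m), (data m).2 - frechet (st (m, data m)))
  else (f, G).
have inv0 n : inv n (data n).
  elim: n => [|n /(hst (n, data n))[] //].
  by split=> //=; rewrite expr0 mulr1.
pose gn n := st (n, data n).
have gnP n : [/\ C1s Omega (gn n),
    lip_mod Omega 0 (4 * C ^+ 2 * L * half n) (gn n) &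
    gn n a0 = (data n).1 a0].
  by have [] := hst (n, data n) (inv0 n).
(* u n is the sum of the first n approximations, DG n its derivative *)
pose u n := f - (data n).1.
pose DG n x := G x - (data n).2 x.
have uS n : u n.+1 = u n + gn n.
  apply/funext => x.
  change (f x - ((data n).1 x - gn n x) = f x - (data n).1 x + gn n x).
  by zmod.
have DGS n x : DG n.+1 x = DG n x + frechet (gn n) x.
  change (G x - ((data n).2 x - frechet (gn n) x) =
    G x - (data n).2 x + frechet (gn n) x).
  by zmod.
have uD n x : Omega x -> strict_diff (u n) x (DG n x).
  move=> Ox; elim: n => [|n IH].
    rewrite /DG /= subrr; apply: (@strict_diff_eq _ _ _ (cst 0) _ _ 1) => //.
      by move=> y _; change (0 = f y - f y); rewrite subrr.
    exact: strict_diff_cst.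
  rewrite uS DGS; apply: strict_diffD IH _.
  by have [gC _ _] := gnP n; exact: strict_diff_frechet gC Ox.
pose B := 4 * C ^+ 2 * L.
have B0 : 0 <= B by rewrite !mulr_ge0 ?exprn_ge0 ?(ltW L0)// (le_trans ler01).
have data0 n : (data n.+1).1 a0 = 0.
  have [_ _ e] := gnP n; change ((data n).1 a0 - gn n a0 = 0).
  by rewrite e subrr.
have gn0 n x : Omega x -> `|gn n.+1 x| <= B * `|x - a0| * half n.
  move=> Ox; have [_ gL ga] := gnP n.+1.
  have := lip_mod0_norm gL (AO _ Aa0) Ox; rewrite ga data0 subr0 -/B => h.
  rewrite (le_trans h)// mulrAC ler_wpM2l ?(mulr_ge0 B0)//.
  by rewrite exprS ler_piMl ?exprn_ge0//; lra.
have /choice[g0 hg0] : forall x, exists l, Omega x ->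
    forall n, `|l - u n.+1 x| <= 2 * (B * `|x - a0|) * half n.
  move=> x; have [Ox|nO] := pselect (Omega x); last by exists 0.
  have [|l hl] := @geometric_limit R Y (fun n => u n.+1 x) (B * `|x - a0|).
    move=> n; rewrite [u n.+2]uS.
    have -> : (u n.+1 + gn n.+1) x - u n.+1 x = gn n.+1 x.
      change (u n.+1 x + gn n.+1 x - u n.+1 x = gn n.+1 x).
      by rewrite addrAC subrr add0r.
    exact: gn0.
  by exists l.
have gA a : A a -> g0 a = f a.
  move=> Aa; apply/eqP; rewrite -subr_eq0 -normr_le0.
  apply: (@le_half_pow0 _ _ (2 * (B * `|a - a0|) + L * `|a - a0|)) => n.
  have h1 := hg0 a (AO _ Aa) n; have [fL _ _] := inv0 n.+1.
  have := lip_mod0_norm fL Aa0 Aa; rewrite data0 subr0 => h2.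
  have -> : g0 a - f a = (g0 a - u n.+1 a) - (data n.+1).1 a.
    change (g0 a - f a = g0 a - (f a - (data n.+1).1 a) - (data n.+1).1 a).
    by zmod.
  rewrite (le_trans (ler_normB _ _))// mulrDl lerD// (le_trans h2)//.
  rewrite mulrAC ler_wpM2l ?mulr_ge0 ?(ltW L0)//.
  by rewrite exprS ler_piMl ?exprn_ge0//; lra.
have uB n : u n.+1 - u n = gn n.
  rewrite uS; apply/funext => x; change (u n x + gn n x - u n x = gn n x).
  by rewrite addrAC subrr add0r.
pose D x := `|g0 x - u 0%N x| + 4 * (B * `|x - a0|).
have hgD x n : Omega x -> `|g0 x - u n x| <= D x * half n.
  move=> Ox; case: n => [|n].
    by rewrite expr0 mulr1 lerDl mulr_ge0// (mulr_ge0 B0).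
  apply: (le_trans (hg0 x Ox n)).
  have -> : D x * half n.+1 = (D x / 2) * half n by rewrite exprS mulrA.
  apply: ler_wpM2r; first by rewrite exprn_ge0.
  have -> : D x / 2 = `|g0 x - u 0%N x| / 2 + 2 * (B * `|x - a0|).
    by rewrite /D; field.
  by rewrite lerDr divr_ge0.
have gnL n : lip_mod Omega 0 (B * half n) (u n.+1 - u n).
  by rewrite uB; have [_ h _] := gnP n.
have tail := lip_mod_limit gnL hgD B0.
have frechet_gn n x : Omega x -> `|DG n.+1 x - DG n x| <= B * half n.
  move=> Ox; have [gC gL _] := gnP n.
  have -> : DG n.+1 x - DG n x = frechet (gn n) x - 0.
    by rewrite DGS subr0 addrAC subrr add0r.
  have hD := strict_diff_frechet gC Ox; have [r r0 rO] := open_ball oOmega Ox.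
  apply/ler_addgt0Pl => t t0; have [d d0 hd] := hD t t0.
  apply: (@lip_mod_dist _ _ _ x (Num.min d r) _ _ t (B * half n)
    (gn n) (gn n)) => //.
  - by rewrite lt_min d0.
  - by rewrite addr_ge0 ?(ltW t0)// (mulr_ge0 B0)// exprn_ge0.
  - by apply: lip_modS hd; exact: ball_minl.
  - by apply: lip_modS gL; apply: subset_trans rO; exact: ball_minr.
(* compare g0 with u n, whose strict derivative DG n x is close to T *)
have strict x T : Omega x -> (forall n, `|DG n x - T| <= 2 * B * half n) ->
    strict_diff g0 x T.
  move=> Ox hT e e0; have e2 : 0 < e / 2 by rewrite divr_gt0.
  have [r r0 rO] := open_ball oOmega Ox.
  have B1 : 0 < 8 * B + 1 by rewrite ltr_wpDl// (mulr_ge0 _ B0).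
  have [n ne] := scale_of_small (divr_gt0 e0 B1).
  have [d d0 hd] := uD n x Ox _ e2.
  exists (Num.min d r); first by rewrite lt_min d0.
  have h1 := lip_modS (@ball_minl _ _ x d r) hd.
  have h2 := lip_modS (subset_trans (@ball_minr _ _ x d r) rO) (tail n).
  have := lip_mod_change T (lip_modD h1 h2); rewrite addr0.
  have -> : u n + (g0 - u n) = g0 by rewrite addrC subrK.
  apply: lip_mod_le; have := hT n; move: ne; rewrite /scale_of ltr_pdivlMr//.
  have : 0 < half n by rewrite exprn_gt0.
  by move=> p0 ne hn; rewrite (le_trans (lerD (lexx _) hn))//; nra.
exists g0; split.
- exact: gA.
- have := tail 0%N; rewrite expr0 mulr1.
  have -> : 2 * B = 8 * C ^+ 2 * L by rewrite /B; ring.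
  apply: eq_lip_mod => x _; change (g0 x - (f x - f x) = g0 x).
  by rewrite subrr subr0.
- move=> x Ox.
  have [T hT] := clinear_geometric_limit (fun n => frechet_gn n x Ox).
  by exists T; apply: strict => // n; rewrite distrC.
- move=> a Aa; apply: strict; first exact: AO.
  move=> n; have [_ _ /(_ a Aa)] := inv0 n.
  have -> : DG n a - G a = - (data n).2 a.
    change (G a - (data n).2 a - G a = - (data n).2 a).
    by rewrite addrAC subrr add0r.
  rewrite normrN => h; apply: (le_trans h); apply: ler_wpM2r.
    by rewrite exprn_ge0.
  have C2 : 1 <= C ^+ 2 by exact: exprn_ege1.
  by rewrite /B; nra.
Qed.

End Iteration.

Theorem theorem34 (R : realType) (X : normedModType R)
    (Y : completeNormedModType R) (C : R) (hC : 1 <= C)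
    (hLE : property_LE X Y C) (hLA : property_LA1 X Y C)
    (Omega : set X) (hopen : open Omega) (hconn : connected Omega)
    (A : set X) (hA : exists2 F : set X, closed F & A = Omega `&` F)
    (L : R) (hL : 0 <= L) (f : X -> Y) (hf : L.-lipschitz_A f)
    (G : X -> clinear X Y) (hW : condition_W A f G)
    (hG : forall x, A x -> `|G x| <= L) :
  exists g : X -> Y,
    [/\ forall x, A x -> g x = f x,
        (16 * C ^+ 3 * L).-lipschitz_Omega g,
        C1_on Omega g
      & forall x, A x -> frechet g x = G x].
Proof.
have C0 : 0 <= C by exact: le_trans ler01 hC.
have K0 : 0 <= 16 * C ^+ 3 * L by rewrite !mulr_ge0// exprn_ge0.
suff [g [gf gL gC gG]] : exists g, [/\ forall x, A x -> g x = f x,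
    lip_mod Omega 0 (16 * C ^+ 3 * L) g, C1s Omega g &
    forall x, A x -> strict_diff g x (G x)].
  exists g; split=> //; [exact/lip_mod0P|exact/(C1_onP g hopen)|].
  by move=> x /gG /strict_diff_differentiable[].
(* L = 0, A empty or Y = 0: a constant map will do *)
have cstP (c : Y) : (forall x, A x -> c = f x) -> (forall x, A x -> G x = 0) ->
    exists g, [/\ forall x, A x -> g x = f x,
    lip_mod Omega 0 (16 * C ^+ 3 * L) g, C1s Omega g &
    forall x, A x -> strict_diff g x (G x)].
  move=> cf G0; exists (cst c); split=> //.
  - by apply: lip_mod_le K0 _; exact: lip_mod_cst.
  - by move=> x _; exists 0; exact: strict_diff_cst.
  - by move=> x /G0 ->; exact: strict_diff_cst.
have [[a0 Aa0]|A0] := pselect (A !=set0); last first.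
  by apply: (cstP 0) => x Ax; exfalso; apply: A0; exists x.
have [L0|Ln0] := eqVneq L 0.
  apply: (cstP (f a0)) => x Ax; last first.
    by apply/eqP; rewrite -normr_le0 -L0; exact: hG.
  apply/eqP; rewrite -subr_eq0 -normr_le0.
  by rewrite (le_trans (hf (a0, x) (conj Aa0 Ax)))//= L0 mul0r.
have [[y yn0]|Y0] := pselect (exists y : Y, y != 0); last first.
  have Y0' (y : Y) : y = 0.
    by apply/eqP; apply: contrapT => yn0; apply: Y0; exists y; exact/negP.
  apply: (cstP 0) => x Ax; first by rewrite [f x]Y0'.
  by apply: val_inj; apply/funext => v; rewrite [LHS]Y0' [RHS]Y0'.
have Lpos : 0 < L by rewrite lt_neqAle eq_sym Ln0.
have hLAb := LA1_on_balls hLA.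
have [g [gf gL gC gG]] := C1_extension hC hLE hLAb (LA_on_balls_scalar yn0 hLAb)
  hopen hA Lpos Aa0 ((lip_mod0P _ _ _).2 hf) hW hG.
exists g; split=> //; apply: lip_mod_le gL.
rewrite ler_wpM2r// [C ^+ 3]exprS.
have : C ^+ 2 <= C * C ^+ 2 by rewrite ler_peMl// exprn_ge0.
have : 0 <= C ^+ 2 by rewrite exprn_ge0.
lra.
Qed.
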